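(* Let $Q:\mathbb{C}^d\to[0,\infty)$ be a $\mathscr{C}^2$ function that is torus-invariant, i.e. $Q(z_1,\dots,z_d)=Q(|z_1|,\dots,|z_d|)$, and assume there exist $\varepsilon>0$ and $R>0$ such that $Q(z)\ge(1+\varepsilon)\log\|z\|$ for $\|z\|\ge R$. Let $V_Q$ be the weighted extremal function $$V_Q(z)=\sup\{w(z): w\in\mathcal{L}(\mathbb{C}^d),\ w\le Q\text{ on }\mathbb{C}^d\}.$$ Then $\Phi_{\Sigma,f}=V_Q$ on $\mathbb{C}^d$, and consequently $dd^c\Phi_{\Sigma,f}=dd^cV_Q$.
   Context: Let $d\ge1$, $\|\cdot\|$ the Euclidean norm, and $\Sigma=\{t\in[0,\infty)^d:\sum_{j=1}^d t_j\le1\}$ the standard simplex. The Lelong class $\mathcal{L}(\mathbb{C}^d)$ consists of all plurisubharmonic functions $v$ on $\mathbb{C}^d$ with $v(z)\le\log^+\|z\|+O(1)$ as $\|z\|\to\infty$. Put $q(s)=Q(e^{s_1},\dots,e^{s_d})$ for $s\in\mathbb{R}^d$, $u(t)=\sup_{s\in\mathbb{R}^d}\big(\langle t,s\rangle-q(s)\big)$ for $t\in\Sigma$ (a finite continuous function on $\Sigma$), and $f=e^{-u}:\Sigma\to(0,\infty)$. For $z\in(\mathbb{C}^* )^d$ let $\operatorname{Log}(z)=(\log|z_1|,\dots,\log|z_d|)$. Define $I_{\Sigma,f}(s)=\sup_{t\in\Sigma}\big(\langle s,t\rangle+\log f(t)\big)$ for $s\in\mathbb{R}^d$ and $$\Phi_{\Sigma,f}(z)=\limsup_{\zeta\to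 z,\ \zeta\in(\mathbb{C}^* )^d}I_{\Sigma,f}(\operatorname{Log}\zeta),\qquad z\in\mathbb{C}^d,$$ which equals $I_{\Sigma,f}(\operatorname{Log}z)$ on $(\mathbb{C}^* )^d$. Here $dd^c=\frac{i}{\pi}\partial\bar\partial$. *)

(* Defs.v *)
From HB Require Import structures.
From mathcomp Require Import all_boot all_order all_algebra.
From mathcomp Require Import complex.
From mathcomp Require Import all_classical all_reals all_analysis.

Set Implicit Arguments.
Unset Strict Implicit.
Unset Printing Implicit Defensive.

Import Order.TTheory GRing.Theory Num.Theory.
Import numFieldNormedType.Exports.
Import ComplexField.Normc.

Local Open Scope classical_set_scope.
Local Open Scope complex_scope.
Local Open Scope ring_scope.

(* A topology on R[i] itself, hence on 'rV[R[i]]_d: the library only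
   instantiates K^o and the abstract numFieldTypes. *)
HB.instance Definition _ (R : rcfType) :=
  PseudoPointedMetric.copy R[i] (R[i])^o.

(* Lebesgue measure on R^n, by recursion on n through R^(n+1) = R x R^n. *)
Section lebesgue_tuple.
Variable R : realType.
Local Notation T := (measurableTypeR R).
Local Open Scope ereal_scope.

Definition cons_pt n (p : T * n.-tuple T) : n.+1.-tuple T := [tuple of p.1 :: p.2].

Lemma measurable_cons_pt n : measurable_fun setT (@cons_pt n).
Proof. by apply: measurable_cons; [exact: measurable_fst|exact: measurable_snd]. Qed.

Section step.
Variables (n : nat) (mu : {sigma_finite_measure set (n.-tuple T) -> \bar R}).

Definition lebesgue_cons : set (n.+1.-tuple T) -> \bar R :=
  pushforward (@lebesgue_measure R \x mu) (@cons_pt n).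

Let m : {measure set (n.+1.-tuple T) -> \bar R} :=
  measure_function_pushforward__canonical__measure_function_Measure
    (@lebesgue_measure R \x mu) (@measurable_cons_pt n).

HB.instance Definition _ := isMeasure.Build _ _ _ lebesgue_cons
  (measure0 m) (measure_ge0 m) (@measure_semi_sigma_additive _ _ _ m).

Let lebesgue_cons_sigma_finite : sigma_finite setT lebesgue_cons.
Proof.
have /sigma_finiteP[F [TF ndF Foo]] := sigma_finiteT (@lebesgue_measure R).
have /sigma_finiteP[G [TG ndG Goo]] := sigma_finiteT mu.
pose split (t : n.+1.-tuple T) : T * n.-tuple T := (thead t, [tuple of behead t]).
have msplit : measurable_fun setT split.
  apply/measurable_fun_pair; last exact: measurable_behead.
  exact: measurable_tnth.
have splitK : split \o @cons_pt n = id.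
  apply/funext => -[x t]; rewrite /split /cons_pt /= theadE; congr pair.
  exact/val_inj.
exists (fun k => split @^-1` (F k `*` G k)).
  rewrite -preimage_bigcup -(preimage_setT split); congr (_ @^-1` _).
  rewrite -setXTT TF TG predeqE => -[x y]; split.
    move=> [/= [i _ Fix] [j _ Gjy]]; exists (maxn i j) => //; split.
    - by move: x Fix; exact/subsetPset/ndF/leq_maxl.
    - by move: y Gjy; exact/subsetPset/ndG/leq_maxr.
  by move=> [i _ []/= ? ?]; split; exists i.
move=> k; have [? ?] := Foo k; have [? ?] := Goo k; split.
  by rewrite -[X in measurable X]setTI; apply: msplit => //; exact: measurableX.
rewrite /lebesgue_cons /pushforward -comp_preimage splitK preimage_id.
by rewrite product_measure1E// lte_mul_pinfty// ge0_fin_numE.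
Qed.

HB.instance Definition _ := Measure_isSigmaFinite.Build _ _ _ lebesgue_cons
  lebesgue_cons_sigma_finite.

End step.

Fixpoint lebesgue_tuple n : {sigma_finite_measure set (n.-tuple T) -> \bar R} :=
  if n is n'.+1 then lebesgue_cons (lebesgue_tuple n') else \d_[tuple].

End lebesgue_tuple.

Section Cd.
Variables (R : realType) (d : nat).
Implicit Types (z : 'rV[R[i]]_d) (v : 'rV[R[i]]_d -> \bar R).

Definition enorm z : R := Num.sqrt (\sum_j normc (z 0 j) ^+ 2).

Definition Cstar : set 'rV[R[i]]_d := [set z | forall j, z 0 j != 0].

Definition Log z : 'rV[R]_d := \row_j ln (normc (z 0 j)).

Definition torus_invariant (Q : 'rV[R[i]]_d -> R) :=
  forall z, Q z = Q (\row_j `|z 0 j|).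

(* R^2d -> C^d, (x, y) |-> x + i y. *)
Definition of_xy (p : 'rV[R]_(d + d)) : 'rV[R[i]]_d :=
  \row_j (p 0 (lshift d j) +i* p 0 (rshift d j)).

End Cd.

Section smooth.
Variable R : realType.

(* Class C^k on R^n, through continuous iterated partial derivatives. *)
Fixpoint Ck n (k : nat) (g : 'rV[R]_n -> R) : Prop :=
  continuous g /\
  if k is k'.+1 then forall i : 'I_n,
    (forall x, derivable g x (delta_mx 0 i)) /\
    Ck k' (fun x => 'D_(delta_mx 0 i) g x)
  else True.

Definition C2 d (Q : 'rV[R[i]]_d -> R) := Ck 2 (Q \o @of_xy R d).

End smooth.

Section psh.
Variable R : realType.
Local Open Scope ereal_scope.

(* Subharmonic on the whole plane, the constant -oo being allowed: upper
   semicontinuous, < +oo, and below its means over circles.  The circle mean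
   is well defined since u is bounded above on the circle. *)
Definition subharmonic (u : R[i] -> \bar R) :=
  [/\ lower_semicontinuous (\- u), forall a, u a < +oo &
      forall (a : R[i]) (r : R), (0 < r)%R ->
        u a <= ((2 * pi)^-1)%:E * \int[@lebesgue_measure R]_(theta in `[0%R, (2 * pi)%R])
                 u (a + r%:C * (cos theta +i* sin theta))%R].

Definition psh d (v : 'rV[R[i]]_d -> \bar R) :=
  [/\ lower_semicontinuous (\- v), (exists z, v z != -oo) &
      forall a b : 'rV[R[i]]_d, subharmonic (fun l => v (a + l *: b)%R)].

Definition lelong d (v : 'rV[R[i]]_d -> \bar R) :=
  psh v /\ exists C M : R, forall z, (M <= enorm z)%R ->
    v z <= (Num.max 0 (ln (enorm z)) + C)%:E.

Definition weighted_extremal d (Q : 'rV[R[i]]_d -> R) (z : 'rV[R[i]]_d) : \bar R :=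
  ereal_sup [set w z | w in [set w | lelong w /\ forall x, w x <= (Q x)%:E]].

End psh.

Section transform.
Variables (R : realType) (d : nat).
Local Open Scope ereal_scope.

Definition dotr (t s : 'rV[R]_d) : R := (\sum_j t 0 j * s 0 j)%R.

Definition simplex : set 'rV[R]_d :=
  [set t | (forall j, 0 <= t 0 j)%R /\ (\sum_j t 0 j <= 1)%R].

(* f is valued in [0, +oo], so that no finiteness has to be assumed for u = -log f. *)
Definition Ifun (S : set 'rV[R]_d) (f : 'rV[R]_d -> \bar R) (s : 'rV[R]_d) :=
  ereal_sup [set (dotr s t)%:E + lne (f t) | t in S].

Definition Phi (S : set 'rV[R]_d) (f : 'rV[R]_d -> \bar R) (z : 'rV[R[i]]_d) :=
  limf_esup (fun zeta => Ifun S f (Log zeta)) (within (@Cstar R d) (nbhs z)).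

Variable Q : 'rV[R[i]]_d -> R.

Definition q_of (s : 'rV[R]_d) : R := Q (\row_j (expR (s 0%R j))%:C).

Definition u_of (t : 'rV[R]_d) : \bar R :=
  ereal_sup [set (dotr t s - q_of s)%:E | s in setT].

Definition f_of (t : 'rV[R]_d) : \bar R := expeR (- u_of t).

End transform.

Section currents.
Variables (R : realType) (d : nat).

Definition pderiv (i : 'I_(d + d)) (g : 'rV[R]_(d + d) -> R[i]) p : R[i] :=
  'D_(delta_mx 0 i) (fun x => complex.Re (g x)) p +i*
  'D_(delta_mx 0 i) (fun x => complex.Im (g x)) p.

(* The Wirtinger operators d/dz_j and d/dzbar_j. *)
Definition dz (j : 'I_d) (g : 'rV[R]_(d + d) -> R[i]) p : R[i] :=
  (pderiv (lshift d j) g p - 'i%C * pderiv (rshift d j) g p) / 2.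

Definition dzbar (j : 'I_d) (g : 'rV[R]_(d + d) -> R[i]) p : R[i] :=
  (pderiv (lshift d j) g p + 'i%C * pderiv (rshift d j) g p) / 2.

Record test_function := TestFunction {
  test_fun :> 'rV[R[i]]_d -> R[i] ;
  _ : forall k, Ck k (fun p => complex.Re (test_fun (of_xy p))) ;
  _ : forall k, Ck k (fun p => complex.Im (test_fun (of_xy p))) ;
  _ : compact (closure [set z | test_fun z != 0]) }.

Definition pt (t : (d + d).-tuple (measurableTypeR R)) : 'rV[R]_(d + d) :=
  \row_i tnth t i.

(* The integral of v g over C^d. *)
Definition pairing (v : 'rV[R[i]]_d -> \bar R) (g : 'rV[R]_(d + d) -> R[i]) : R[i] :=
  let I (h : R[i] -> R) :=
    fine (\int[lebesgue_tuple R (d + d)]_t (v (of_xy (pt t)) * (h (g (pt t)))%:E))%E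
  in I (@complex.Re R) +i* I (@complex.Im R).

(* dd^c v = (i/pi) sum_(j,k) d^2 v / dz_j dzbar_k  dz_j /\ dzbar_k, a current
   of bidegree (1,1) given by its distribution coefficients. *)
Definition ddc (v : 'rV[R[i]]_d -> \bar R) (j k : 'I_d) (chi : test_function) : R[i] :=
  'i%C / (pi : R)%:C * pairing v (dz j (dzbar k (chi \o @of_xy R d))).

End currents.

(* Main.v *)
Require Import Defs.
From mathcomp Require Import all_boot all_order all_algebra.
From mathcomp Require Import complex.
From mathcomp Require Import all_classical all_reals all_analysis.
From mathcomp Require Import ring lra.

(** Write v_t(z) = sum_j t_j ln |z_j| - u(t) for t in the simplex.  On the points
    with nonzero coordinates the transform is sup_t v_t, so the theorem says that
    these simplest torus-invariant members of the Lelong class already compute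
    the extremal function.

    Phi <= V_Q.  Each v_t is plurisubharmonic, of logarithmic growth, and below Q
    because u is the Legendre transform of q.  Replacing ln |z_j| by
    1/2 ln (|z_j|^2 + dl) gives finite continuous functions (competitor), whose
    circle means are means of continuous functions.  Their subharmonicity comes
    from the factorisation |z + w e^(ix)|^2 + dl = c |1 + kappa e^(ix)|^2 with
    |kappa| < 1 and c >= |z|^2 + dl, together with Jensen's formula
    (ln_sqnorm_submean).  Evaluating the competitor at z is evaluating v_t at the
    point with coordinates sqrt (|z_j|^2 + dl), so it stays below Q up to a constant
    that tends to 0 with dl: on a ball by uniform continuity of Q, outside by the
    growth of Q (competitor_le_Q).  Since dl does not depend on t and the weights
    t_j sum to at most 1, the competitors are equicontinuous, and the upper limit
    defining Phi is controlled at every point, coordinate hyperplanes included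
    (Phi_le_weighted_extremal).

    V_Q <= Phi.  Let w be in the Lelong class with w <= Q, and let g(s) be the
    supremum of w on the torus |z_j| = e^(s_j).  The key point is that g is convex
    (log_convex).  Otherwise g would be touched from above at some point by a smooth
    function phi of s that is strictly concave in one direction a.  At a point z
    of the torus where w attains g, w is touched by phi (ln |z_1|, ..., ln |z_d|).
    On the complex line z_j (1 + l a_j) the functions ln |1 + l a_j| are harmonic
    near l = 0, so for a small circle the mean of the touching function falls below
    its value at the centre by a quantity of the order of the square of the radius,
    against the submean inequality for w (no_concave_touch).  A finite convex function
    has a subgradient t at each s (subgradient).  The logarithmic growth of w, and its
    boundedness on compact sets, put t in the simplex (subgradient_in_simplex); and
    g <= q turns the subgradient inequality into g(s) <= <t, s> - u(t)
    (le_Ifun_Log).  A point on coordinate hyperplanes is the centre of small circles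
    which avoid them, and the submean inequality passes the bound on to it
    (le_Phi). *)

Set Implicit Arguments.
Unset Strict Implicit.
Unset Printing Implicit Defensive.

Import Order.TTheory GRing.Theory Num.Theory.
Import numFieldNormedType.Exports.
Import ComplexField.Normc.

Local Open Scope ring_scope.


(** * Averages over a circle *)

Section circle_average.
Variable R : realType.
Local Notation mu := (@lebesgue_measure R).
Implicit Types h H : R -> R.
Local Open Scope classical_set_scope.

Definition circle_avg h : R := (2 * pi)^-1 * \int[mu]_(x in `[0, 2 * pi]) h x.

Lemma pi2_gt0 : 0 < 2 * pi :> R.
Proof. by rewrite mulr_gt0// pi_gt0. Qed.

Lemma continuous_integrable_itv h a b : continuous h ->
  mu.-integrable `[a, b] (EFin \o h).
Proof.
move=> ch; apply: continuous_compact_integrable; first exact: segment_compact.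
exact: continuous_subspaceT.
Qed.

Lemma integral_circle_avg h : continuous h ->
  (((2 * pi)^-1)%:E * \int[mu]_(x in `[0%R, (2 * pi)%R]) (h x)%:E)%E =
  (circle_avg h)%:E.
Proof.
move=> ch; rewrite /circle_avg /Rintegral EFinM fineK//.
apply: integrable_fin_num => //; exact: continuous_integrable_itv.
Qed.

Lemma circle_avgD h1 h2 : continuous h1 -> continuous h2 ->
  circle_avg (fun x => h1 x + h2 x) = circle_avg h1 + circle_avg h2.
Proof.
move=> c1 c2; rewrite /circle_avg RintegralD// ?mulrDr//;
  exact: continuous_integrable_itv.
Qed.

Lemma circle_avgZ k h : continuous h ->
  circle_avg (fun x => k * h x) = k * circle_avg h.
Proof.
move=> ch; rewrite /circle_avg RintegralZl//; first by rewrite mulrCA.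
exact: continuous_integrable_itv.
Qed.

Lemma circle_avg_cst k : circle_avg (fun=> k) = k.
Proof.
rewrite /circle_avg Rintegral_cst//= lebesgue_measure_itv/= lte_fin pi2_gt0/=.
rewrite oppr0 addr0 mulrC mulfK//; apply: lt0r_neq0; exact: pi2_gt0.
Qed.

Lemma le_circle_avg h1 h2 : continuous h1 -> continuous h2 ->
  (forall x, h1 x <= h2 x) -> circle_avg h1 <= circle_avg h2.
Proof.
move=> c1 c2 le12; apply: ler_wpM2l; first by rewrite invr_ge0 ltW// pi2_gt0.
by apply: le_Rintegral => //; exact: continuous_integrable_itv.
Qed.

Lemma circle_avg_sum (I : Type) (r : seq I) (h : I -> R -> R) :
  (forall i, continuous (h i)) ->
  circle_avg (fun x => \sum_(i <- r) h i x) = \sum_(i <- r) circle_avg (h i).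
Proof.
move=> ch; elim: r => [|i r IH].
  rewrite big_nil -[RHS](circle_avg_cst 0); congr circle_avg.
  by apply/funext => x; rewrite big_nil.
rewrite big_cons -IH -circle_avgD//.
  by congr circle_avg; apply/funext => x; rewrite big_cons.
by move=> x; apply: cvg_big => [|j _]; [exact: add_continuous|exact: ch].
Qed.

(** The integrals of the positive and negative parts are suprema over the simple
    functions below them, so the comparison holds for arbitrary functions.  It
    serves to bound the circle means of functions known only to be semicontinuous. *)
Lemma ge_integral (f g : R -> \bar R) (D : set R) :
  (forall x, D x -> (f x <= g x)%E) ->
  (\int[mu]_(x in D) f x <= \int[mu]_(x in D) g x)%E.
Proof.
move=> fg; rewrite /integral; apply: leeB.
  apply: le_ereal_sup => _ [h /= hf <-]; exists h => //= x.
  apply: (le_trans (hf x)); rewrite !funeposE; apply: le_max2 => //.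
  by rewrite /patch; case: ifPn => // /set_mem; exact: fg.
apply: le_ereal_sup => _ [h /= hf <-]; exists h => //= x.
apply: (le_trans (hf x)); rewrite !funenegE; apply: le_max2 => //.
by rewrite /patch leeN2; case: ifPn => // /set_mem; exact: fg.
Qed.

Lemma integral_le_circle_avg (f : R -> \bar R) h : continuous h ->
  (forall x, (f x <= (h x)%:E)%E) ->
  (((2 * pi)^-1)%:E * \int[mu]_(x in `[0%R, (2 * pi)%R]) f x <=
   (circle_avg h)%:E)%E.
Proof.
move=> ch fh; rewrite -integral_circle_avg//; apply: lee_wpmul2l.
  by rewrite lee_fin invr_ge0 ltW// pi2_gt0.
exact: ge_integral.
Qed.

Lemma antiderivative h (M : R) : continuous h ->
  exists H, forall x, - M < x < M -> is_derive x 1 H (h x).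
Proof.
move=> ch; exists (fun x => \int[mu]_(t in `[- M, x]) h t) => x /andP[Mx xM].
have [] := @continuous_FTC1_closed R h (- M) x M xM _ Mx (ch x).
  exact: continuous_integrable_itv.
by move=> d1 d2; apply: DeriveDef => //; rewrite -derive1E.
Qed.

Lemma circle_avg_antiderivative h H : continuous h ->
  (forall x, -1 < x < 2 * pi + 1 -> is_derive x 1 H (h x)) ->
  circle_avg h = (2 * pi)^-1 * (H (2 * pi) - H 0).
Proof.
move=> ch dH; congr (_ * _); rewrite /Rintegral.
have in1 x : 0 <= x <= 2 * pi -> -1 < x < 2 * pi + 1 by move=> /andP[? ?]; apply/andP; split; lra.
have p0 := pi2_gt0.
have cH x : 0 <= x <= 2 * pi -> {for x, continuous H}.
  move=> /in1 /dH dHx; apply: differentiable_continuous; apply/derivable1_diffP.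
  exact: ex_derive.
rewrite (@continuous_FTC2 _ h H)//.
- exact: continuous_subspaceT.
- split.
  + by move=> x /[!in_itv]/= /andP[x0 x1]; apply: ex_derive; apply: dH; apply: in1; rewrite !ltW.
  + by apply: cvg_at_right_filter; apply: cH; rewrite lexx ltW.
  + by apply: cvg_at_left_filter; apply: cH; rewrite lexx ltW.
- move=> x /[!in_itv]/= /andP[x0 x1]; rewrite derive1E; apply: derive_val.
  by apply: dH; apply: in1; rewrite !ltW.
Qed.

(** The derivative of H (t + 2 pi) - H t is h (t + 2 pi) - h t = 0. *)
Lemma antiderivative_periodic h H (M t : R) : 0 <= t -> t + 2 * pi < M ->
  (forall x, - M < x < M -> is_derive x 1 H (h x)) ->
  (forall x, h (x + 2 * pi) = h x) ->
  H (t + 2 * pi) - H t = H (2 * pi) - H 0.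
Proof.
move=> t0 tM dH hper; have p0 := pi2_gt0.
pose D x := H (x + 2 * pi) - H x.
have dD x : 0 <= x <= t -> is_derive x 1 D 0.
  move=> /andP[x0 xt].
  have d1 : is_derive x 1 (fun y => H (y + 2 * pi)) (h x).
    rewrite -hper -[X in is_derive _ _ _ X]mulr1.
    apply: (@is_derive1_comp R H (fun y => y + 2 * pi)).
      apply: dH; apply/andP; split; lra.
    by rewrite -[X in is_derive _ _ _ X]addr0; apply: is_deriveD.
  have d2 : is_derive x 1 H (h x) by apply: dH; apply/andP; split; lra.
  by rewrite -(subrr (h x)); apply: is_deriveB.
have [||c _] := @MVT_segment R D (fun=> 0) 0 t t0.
- by move=> x /[!in_itv]/= /andP[x0 xt]; apply: dD; rewrite !ltW.
- apply: continuous_in_subspaceT => x /set_mem /=; rewrite in_itv/= => xt.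
  apply: differentiable_continuous; apply/derivable1_diffP.
  by apply: ex_derive; exact: dD.
- by rewrite /D mul0r add0r => /eqP; rewrite subr_eq0 => /eqP.
Qed.

(** With an antiderivative H of h, this is the preceding identity for H. *)
Lemma circle_avg_shift h t : continuous h -> 0 <= t ->
  (forall x, h (x + 2 * pi) = h x) ->
  circle_avg (fun x => h (x + t)) = circle_avg h.
Proof.
move=> ch t0 hper; have p0 := pi2_gt0.
have [H dH] := antiderivative (t + 2 * pi + 2) ch.
have dH0 x : -1 < x < 2 * pi + 1 -> is_derive x 1 H (h x).
  by move=> /andP[x1 x2]; apply: dH; apply/andP; split; lra.
have dHt x : -1 < x < 2 * pi + 1 -> is_derive x 1 (fun y => H (y + t)) (h (x + t)).
  move=> /andP[x1 x2]; rewrite -[X in is_derive _ _ _ X]mulr1.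
  apply: (@is_derive1_comp R H (fun y => y + t)).
    by apply: dH; apply/andP; split; lra.
  by rewrite -[X in is_derive _ _ _ X]addr0; apply: is_deriveD.
have cht : continuous (fun x => h (x + t)).
  by move=> x; apply: continuous_comp; [apply: cvgD; [exact: cvg_id|exact: cvg_cst]|exact: ch].
rewrite (circle_avg_antiderivative cht dHt) (circle_avg_antiderivative ch dH0).
rewrite add0r [2 * pi + t]addrC.
by rewrite (antiderivative_periodic t0 _ dH hper)//; lra.
Qed.

(** H (2 x) / 2 is an antiderivative of h (2 x), and H increases by the same amount
    over each of the two periods in [0, 4 pi]. *)
Lemma circle_avg_double h : continuous h -> (forall x, h (x + 2 * pi) = h x) ->
  circle_avg (fun x => h (2 * x)) = circle_avg h.
Proof.
move=> ch hper; have p0 := pi2_gt0.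
have [H dH] := antiderivative (2 * (2 * pi) + 4) ch.
have dH0 x : -1 < x < 2 * pi + 1 -> is_derive x 1 H (h x).
  by move=> /andP[x1 x2]; apply: dH; apply/andP; split; lra.
have dH2 x : -1 < x < 2 * pi + 1 ->
    is_derive x 1 (fun y => 2^-1 * H (2 * y)) (h (2 * x)).
  move=> /andP[x1 x2].
  have d1 : is_derive x 1 (fun y => H (2 * y)) (h (2 * x) * 2).
    apply: (@is_derive1_comp R H (fun y => 2 * y)).
      by apply: dH; apply/andP; split; lra.
    by have /is_derive_eq := @is_deriveZ _ _ _ id 2 x 1 1 (is_derive_id _ _); apply; exact: mulr1.
  have /is_derive_eq := @is_deriveZ _ _ _ (fun y : R => H (2 * y)) 2^-1 x 1 _ d1; apply.
  by rewrite /GRing.scale/= mulrCA mulVf ?mulr1.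
have ch2 : continuous (fun x : R => h (2 * x)).
  move=> x; apply: continuous_comp; last exact: ch.
  by apply: cvgM; [exact: cvg_cst|exact: cvg_id].
rewrite (circle_avg_antiderivative ch2 dH2) (circle_avg_antiderivative ch dH0).
rewrite mulr0 (_ : 2 * (2 * pi) = 2 * pi + 2 * pi :> R); last by ring.
have E := @antiderivative_periodic h H _ (2 * pi) (ltW p0) _ dH hper.
congr (_ * _); move: E.
move: (H (2 * pi + 2 * pi)) (H (2 * pi)) (H 0) => x y z E.
have {}E : x - y = y - z by apply: E; lra.
lra.
Qed.

End circle_average.

(** * Jensen's formula for the logarithm of |1 + kappa e^(ix)| *)

Section jensen.
Variable R : realType.
Implicit Types p q s x : R.
Local Open Scope classical_set_scope.

Lemma circle_avg_cos : circle_avg (@cos R) = 0.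
Proof.
have c := @continuous_cos R.
have := circle_avg_shift c (pi_ge0 R).
have -> : (fun x => cos (x + pi)) = (fun x => -1 * cos x) :> (R -> R).
  by apply/funext => x; rewrite cosDpi mulN1r.
rewrite circle_avgZ// => E.
have {}E : -1 * circle_avg cos = circle_avg (@cos R).
  by apply: E => x; rewrite mulr_natl cosD2pi.
lra.
Qed.

Lemma cos2xE x : cos (2 * x) = 2 * cos x ^+ 2 - 1.
Proof. by rewrite mulr_natl cos_mulr2n mulr_natl. Qed.

Lemma sin2xE x : sin (2 * x) = 2 * (cos x * sin x).
Proof. by rewrite mulr_natl sin_mulr2n mulr_natl. Qed.

Lemma circle_avg_cos2 : circle_avg (fun x : R => cos x ^+ 2) = 2^-1.
Proof.
have c := @continuous_cos R.
have -> : (fun x => cos x ^+ 2) = (fun x => 2^-1 + 2^-1 * cos (2 * x)) :> (R -> R).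
  by apply/funext => x; rewrite cos2xE; lra.
have c2 : continuous (fun x : R => cos (2 * x)).
  move=> x; apply: continuous_comp; last exact: continuous_cos.
  by apply: cvgM; [exact: cvg_cst|exact: cvg_id].
rewrite circle_avgD ?circle_avg_cst.
- rewrite circle_avgZ// circle_avg_double// ?circle_avg_cos ?mulr0 ?addr0//.
  by move=> x; rewrite mulr_natl cosD2pi.
- by move=> x; exact: cvg_cst.
- by move=> x; apply: cvgM; [exact: cvg_cst|exact: c2].
Qed.

(** This is |1 + kappa e^(ix)|^2 for kappa = p + i q. *)
Definition sqnorm1D p q x : R := 1 + 2 * (p * cos x - q * sin x) + (p ^+ 2 + q ^+ 2).

(** The left-hand side is the square of the real part of kappa e^(ix). *)
Lemma sqr_cos_sin p q x : (p * cos x - q * sin x) ^+ 2 <= p ^+ 2 + q ^+ 2.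
Proof.
have := cos2Dsin2 x; move: (cos x) (sin x) => c s cs.
have -> : p ^+ 2 + q ^+ 2 = (p * c - q * s) ^+ 2 + (p * s + q * c) ^+ 2.
  by transitivity ((p ^+ 2 + q ^+ 2) * (c ^+ 2 + s ^+ 2)); [rewrite cs mulr1|ring].
by rewrite lerDl sqr_ge0.
Qed.

(** |1 + kappa e^(ix)| lies between 1 - |kappa| and 1 + |kappa|. *)
Lemma sqnorm1D_bound (m : R) p q x : 0 <= m < 1 -> p ^+ 2 + q ^+ 2 <= m ^+ 2 ->
  (1 - m) ^+ 2 <= sqnorm1D p q x <= 4.
Proof.
move=> /andP[m0 m1] pqm; rewrite /sqnorm1D; have := sqr_cos_sin p q x.
move: (p * cos x - q * sin x) => y y2.
have : `|y| <= m.
  rewrite -(ler_pXn2r (n := 2))// ?nnegrE// -normrX ger0_norm ?sqr_ge0//.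
  exact: le_trans pqm.
rewrite ler_norml => /andP[ym yM]; move: (p ^+ 2 + q ^+ 2) y2 pqm => s y2 pqm.
by apply/andP; split; nra.
Qed.

Lemma sqnorm1D_gt0 p q x : p ^+ 2 + q ^+ 2 < 1 -> 0 < sqnorm1D p q x.
Proof.
move=> s1; set m := Num.sqrt (p ^+ 2 + q ^+ 2).
have m2 : m ^+ 2 = p ^+ 2 + q ^+ 2 by rewrite sqr_sqrtr// addr_ge0// sqr_ge0.
have m0 : 0 <= m by exact: sqrtr_ge0.
have m1 : m < 1 by rewrite -(ltr_pXn2r (n := 2))// ?nnegrE// expr1n m2.
have m01 : 0 <= m < 1 by rewrite m0.
have pqm : p ^+ 2 + q ^+ 2 <= m ^+ 2 by rewrite m2.
have /andP[+ _] := sqnorm1D_bound x m01 pqm.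
by apply: lt_le_trans; rewrite exprn_gt0// subr_gt0.
Qed.

Lemma continuous_sqnorm1D p q : continuous (sqnorm1D p q).
Proof.
move=> x; rewrite /sqnorm1D; apply: cvgD; last exact: cvg_cst.
apply: cvgD; first exact: cvg_cst.
apply: cvgM; first exact: cvg_cst.
by apply: cvgB; apply: cvgM; try exact: cvg_cst; [exact: continuous_cos|exact: continuous_sin].
Qed.

Lemma continuous_ln_comp (h : R -> R) : continuous h -> (forall x, 0 < h x) ->
  continuous (fun x => ln (h x)).
Proof.
by move=> ch h0 x; apply: continuous_comp; [exact: ch|exact: continuous_ln].
Qed.

Lemma continuous_ln_sqnorm1D p q : p ^+ 2 + q ^+ 2 < 1 ->
  continuous (fun x => ln (sqnorm1D p q x)).
Proof.
move=> s1; apply: continuous_ln_comp; first exact: continuous_sqnorm1D.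
by move=> x; exact: sqnorm1D_gt0.
Qed.

Lemma sqnorm1D_periodic p q x : sqnorm1D p q (x + 2 * pi) = sqnorm1D p q x.
Proof. by rewrite /sqnorm1D (mulr_natl (pi : R) 2) cosD2pi sinD2pi. Qed.

(** From |1 + kappa e^(ix)| |1 - kappa e^(ix)| = |1 - kappa^2 e^(2ix)|: the two
    factors on the left have the same logarithmic mean by a half-turn, and doubling
    the angle does not change a mean.  Here P + i Q = - kappa^2. *)
Lemma jensen_double p q : p ^+ 2 + q ^+ 2 < 1 ->
  let P := - (p ^+ 2 - q ^+ 2) in let Q := - (2 * p * q) in
  circle_avg (fun x => ln (sqnorm1D p q x)) =
  2^-1 * circle_avg (fun x => ln (sqnorm1D P Q x)).
Proof.
move=> s1 P Q.
have S2 : P ^+ 2 + Q ^+ 2 = (p ^+ 2 + q ^+ 2) ^+ 2 by rewrite /P /Q; ring.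
have S1 : P ^+ 2 + Q ^+ 2 < 1.
  by rewrite S2 exprn_ilt1 // addr_ge0 // sqr_ge0.
have c1 := continuous_ln_sqnorm1D s1.
have sN : (- p) ^+ 2 + (- q) ^+ 2 < 1 by rewrite !sqrrN.
have c2 := continuous_ln_sqnorm1D sN.
have E1 := circle_avg_shift c1 (pi_ge0 R) (fun x => congr1 (@ln R) (sqnorm1D_periodic p q x)).
have E2 := circle_avg_double (continuous_ln_sqnorm1D S1)
  (fun x => congr1 (@ln R) (sqnorm1D_periodic P Q x)).
have E3 : (fun x => ln (sqnorm1D p q (x + pi))) = (fun x => ln (sqnorm1D (- p) (- q) x)).
  apply/funext => x; congr ln; rewrite /sqnorm1D cosDpi sinDpi; ring.
have E4 : (fun x => ln (sqnorm1D P Q (2 * x))) =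
    (fun x => ln (sqnorm1D p q x) + ln (sqnorm1D (- p) (- q) x)).
  apply/funext => x; rewrite -lnM ?posrE ?sqnorm1D_gt0//; congr ln.
  rewrite /sqnorm1D cos2xE sin2xE /P /Q.
  have := cos2Dsin2 x; move: (cos x) (sin x) => c s cs.
  transitivity ((1 + 2 * (p * c - q * s) + (p ^+ 2 + q ^+ 2)) *
    (1 + 2 * (- p * c - - q * s) + ((- p) ^+ 2 + (- q) ^+ 2)) -
    4 * q ^+ 2 * (1 - (c ^+ 2 + s ^+ 2))); first by ring.
  by rewrite cs subrr mulr0 subr0.
move: E2; rewrite E4 circle_avgD// -E3 E1 => E2; lra.
Qed.

(** Squaring kappa keeps it in the disc of radius m, so the halving of the mean can
    be iterated. *)
Lemma jensen_bound (m : R) n p q : 0 <= m < 1 -> p ^+ 2 + q ^+ 2 <= m ^+ 2 ->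
  `|circle_avg (fun x => ln (sqnorm1D p q x))| <=
    (`|ln 4| + `|ln ((1 - m) ^+ 2)|) * 2^-1 ^+ n.
Proof.
move=> m01; have /andP[m0 m1] := m01.
set B : R := `|ln 4| + _; elim: n p q => [|n IH] p q pqm.
  have s1 : p ^+ 2 + q ^+ 2 < 1 by rewrite (le_lt_trans pqm)// exprn_ilt1.
  rewrite expr0 mulr1 ler_norml.
  have lb x : - B <= ln (sqnorm1D p q x) <= B.
    have /andP[l1 l2] := sqnorm1D_bound x m01 pqm.
    have g0 := sqnorm1D_gt0 x s1.
    have /andP[a1 a2] : ln ((1 - m) ^+ 2) <= ln (sqnorm1D p q x) <= ln 4.
      by rewrite !ler_ln ?posrE// ?l1 ?l2// exprn_gt0// subr_gt0.
    have := ler_norm (ln 4 : R); have := ler_norm (- ln ((1 - m) ^+ 2)).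
    have := normr_ge0 (ln 4 : R); have := normr_ge0 (ln ((1 - m) ^+ 2)).
    by rewrite normrN /B => ? ? ? ?; apply/andP; split; lra.
  have cc (k : R) : continuous (fun _ : R => k) by move=> x; exact: cvg_cst.
  have cl := continuous_ln_sqnorm1D s1.
  apply/andP; split.
    rewrite -[leLHS]circle_avg_cst; apply: le_circle_avg => // x.
    by have /andP[] := lb x.
  rewrite -[leRHS]circle_avg_cst; apply: le_circle_avg => // x.
  by have /andP[] := lb x.
have s1 : p ^+ 2 + q ^+ 2 < 1 by rewrite (le_lt_trans pqm)// exprn_ilt1.
rewrite jensen_double// normrM ger0_norm// [X in B * X]exprS [leRHS]mulrCA.
apply: ler_wpM2l => //; apply: IH.
have -> : (- (p ^+ 2 - q ^+ 2)) ^+ 2 + (- (2 * p * q)) ^+ 2 = (p ^+ 2 + q ^+ 2) ^+ 2.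
  by ring.
rewrite -[leRHS]mulr1 expr2; apply: ler_pM => //; try by rewrite addr_ge0// sqr_ge0.
exact: ltW.
Qed.

(** The mean value property of the harmonic function ln |1 + z| on the disc,
    obtained from the doubling identity, which forces the mean to vanish. *)
Theorem jensen p q : p ^+ 2 + q ^+ 2 < 1 ->
  circle_avg (fun x => ln (sqnorm1D p q x)) = 0.
Proof.
move=> s1; set m := Num.sqrt (p ^+ 2 + q ^+ 2).
have m2 : m ^+ 2 = p ^+ 2 + q ^+ 2 by rewrite sqr_sqrtr// addr_ge0// sqr_ge0.
have m0 : 0 <= m by exact: sqrtr_ge0.
have m1 : m < 1 by rewrite -(ltr_pXn2r (n := 2))// ?nnegrE// expr1n m2.
have m01 : 0 <= m < 1 by rewrite m0.
pose B : R := `|ln 4| + `|ln ((1 - m) ^+ 2)|.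
apply/eqP; rewrite -normr_le0.
have c0 : (fun n => B * 2^-1 ^+ n) @ \oo --> (0 : R).
  rewrite -[X in _ --> X](mulr0 B); apply: cvgM; first exact: cvg_cst.
  by apply: cvg_expr; rewrite ger0_norm// invf_lt1// ltr1n.
rewrite -(cvg_lim _ c0)//; apply: limr_ge; first by apply/cvg_ex; exists 0.
by apply: nearW => n; apply: jensen_bound; rewrite ?m2.
Qed.

End jensen.

(** * Complex neighbourhoods, and subharmonicity of ln (|z|^2 + dl) *)

Section row_maps.
Local Open Scope classical_set_scope.

Lemma continuous_row (T U : topologicalType) n (f : T -> 'rV[U]_n) :
  (forall j, continuous (fun x => f x 0 j)) -> continuous f.
Proof.
move=> cf x A [P Px PA].
have : \forall y \near x, forall j, P 0 j (f y 0 j).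
  by apply: filter_forall => j; apply: cf; exact: Px.
by apply: filterS => y Py; apply: PA => i j; rewrite ord1.
Qed.

Lemma continuous_coord (U : topologicalType) n (j : 'I_n) :
  continuous (fun x : 'rV[U]_n => x 0 j).
Proof.
move=> x A Ax; exists (fun i k => if (i == 0) && (k == j) then A else setT).
  by move=> i k; case: ifPn => [/andP[/eqP -> /eqP ->]//|_]; exact: filterT.
by move=> y /(_ 0 j); rewrite !eqxx.
Qed.

End row_maps.

Section complex_norm.
Variable R : realType.
Implicit Types z w : R[i].
Local Open Scope classical_set_scope.
Local Open Scope complex_scope.
Local Notation nC z := (normc z : R).

Lemma normc_ge0 z : 0 <= nC z.
Proof. by case: z => a b; exact: sqrtr_ge0. Qed.

Lemma sqr_normcE z : nC z ^+ 2 = complex.Re z ^+ 2 + complex.Im z ^+ 2.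
Proof. by case: z => a b /=; rewrite sqr_sqrtr// addr_ge0// sqr_ge0. Qed.

Lemma normr_normc z : `|z| = (nC z)%:C.
Proof. by rewrite normc_def; case: z. Qed.

Lemma normc_real (a : R) : normc a%:C = `|a|.
Proof. by rewrite /= expr0n addr0 sqrtr_sqr. Qed.

Lemma normc_gt0 z : (0 < nC z) = (z != 0).
Proof.
rewrite lt0r normc_ge0 andbT; congr (~~ _); apply/eqP/eqP => [/eq0_normc//|->].
exact: normc0.
Qed.

Lemma normc_dist z w : `|nC z - nC w| <= nC (z - w).
Proof.
have D : forall x y, nC x - nC y <= nC (x - y).
  move=> x y; rewrite lerBlDr; apply: le_trans (le_normcD _ _); by rewrite subrK.
rewrite ler_norml D andbT lerNl opprB -[nC (z - w)]normcN opprB; exact: D.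
Qed.

(** Balls of R[i] have radii in R[i]; a positive radius is a real number, so real
    radii suffice. *)
Lemma nbhs_complexP z (A : set R[i]) :
  nbhs z A <-> exists2 e : R, 0 < e & forall w, nC (w - z) < e -> A w.
Proof.
have B (e : R) w : ball z e%:C w <-> nC (w - z) < e.
  rewrite -[nC (w - z)]normcN opprB -ltcR -normr_normc; exact: iff_refl.
rewrite -nbhs_ballE; split => [[e /= e0 eA]|[e e0 eA]].
  have eE : (complex.Re e)%:C = e by rewrite RRe_real// gtr0_real.
  exists (complex.Re e); first by rewrite -ltcR eE.
  by move=> w /B; rewrite eE; exact: eA.
by exists e%:C => /= [|w /B /eA//]; rewrite ltcR.
Qed.

Lemma normc_affine_continuous (a b : R[i]) : continuous (fun l : R[i] => nC (a + l * b)).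
Proof.
move=> l; apply/(@cvgrPdist_lt _ _ _ (nbhs l) (@nbhs_filter R[i] l)) => e e0.
have b0 : 0 < nC b + 1 by rewrite ltr_wpDl// normc_ge0.
apply/nbhs_complexP; exists (e / (nC b + 1)); first by rewrite divr_gt0.
move=> w wl; rewrite (le_lt_trans (normc_dist _ _))//.
rewrite (_ : _ - _ = (l - w) * b); last by ring.
rewrite normcM -[nC (l - w)]normcN opprB; move: wl; rewrite ltr_pdivlMr// => wl.
apply: le_lt_trans wl; apply: ler_wpM2l; first exact: normc_ge0.
by rewrite lerDl.
Qed.

Lemma nbhs_rowP d (z : 'rV[R[i]]_d) (A : set 'rV[R[i]]_d) :
  nbhs z A <->
  exists2 e : R, 0 < e & forall w : 'rV[R[i]]_d, (forall j, nC (w 0 j - z 0 j) < e) -> A w.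
Proof.
have B (e : R) (a w : R[i]) : ball a e%:C w <-> nC (w - a) < e.
  rewrite -[nC (w - a)]normcN opprB -ltcR -normr_normc; exact: iff_refl.
rewrite -nbhs_ballE; split => [[e /= e0 eA]|[e e0 eA]].
  have eE : (complex.Re e)%:C = e by rewrite RRe_real// gtr0_real.
  exists (complex.Re e); first by rewrite -ltcR eE.
  by move=> w wz; apply: eA; split => // i j; rewrite ord1 -eE; apply/B.
exists e%:C => /= [|w [_ zw]]; first by rewrite ltcR.
by apply: eA => j; apply/B; exact: zw.
Qed.

(** With X = |z|^2 and Y = |w|^2, the number c is the larger root of
    c^2 - (X + Y + dl) c + X Y, which makes |z + w e^(ix)|^2 + dl equal to
    c |1 + kappa e^(ix)|^2 for kappa = conj(z) w / c. *)
Lemma larger_root (X Y dl : R) : 0 <= X -> 0 <= Y -> 0 < dl ->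
  exists c, [/\ 0 < c, X + dl <= c, c ^+ 2 + X * Y = (X + Y + dl) * c & X * Y < c ^+ 2].
Proof.
move=> X0 Y0 dl0; set D := Num.sqrt ((X - Y + dl) ^+ 2 + 4 * (Y * dl)).
have D2 : D ^+ 2 = (X - Y + dl) ^+ 2 + 4 * (Y * dl).
  by rewrite sqr_sqrtr// addr_ge0// ?sqr_ge0// !mulr_ge0// ltW.
have D0 : 0 <= D by exact: sqrtr_ge0.
move: (D) D2 D0 => {}D D2 D0.
have Dl : X - Y + dl <= D by rewrite leNgt; apply/negP => Dl; nra.
exists ((X + Y + dl + D) / 2); split; [lra|lra|lra|nra].
Qed.

(** By the factorisation above and Jensen's formula the mean on the right is ln c,
    where c >= |z|^2 + dl. *)
Lemma ln_sqnorm_submean (z w : R[i]) (dl : R) : 0 < dl ->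
  ln (nC z ^+ 2 + dl) <=
  circle_avg (fun x => ln (nC (z + w * (cos x +i* sin x)) ^+ 2 + dl)).
Proof.
case: z w => [z1 z2] [w1 w2] dl0; rewrite sqr_normcE /=.
pose X := z1 ^+ 2 + z2 ^+ 2; pose Y := w1 ^+ 2 + w2 ^+ 2.
have X0 : 0 <= X by rewrite addr_ge0// sqr_ge0.
have Y0 : 0 <= Y by rewrite addr_ge0// sqr_ge0.
pose P := z1 * w1 + z2 * w2; pose Q := z1 * w2 - z2 * w1.
have PQ : P ^+ 2 + Q ^+ 2 = X * Y by rewrite /P /Q /X /Y; ring.
pose A := X + Y + dl.
have [c [c0 cX cE XYc]] := larger_root X0 Y0 dl0.
have s1 : (P / c) ^+ 2 + (Q / c) ^+ 2 < 1.
  by rewrite !expr_div_n -mulrDl PQ ltr_pdivrMr ?exprn_gt0// mul1r.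
have E : (fun x => ln (nC ((z1 +i* z2) + (w1 +i* w2) * (cos x +i* sin x)) ^+ 2 + dl)) =
         (fun x => ln c + ln (sqnorm1D (P / c) (Q / c) x)).
  apply/funext => x; rewrite -lnM ?posrE ?sqnorm1D_gt0//; congr ln.
  rewrite sqr_normcE /= /sqnorm1D.
  have -> : c * (1 + 2 * (P / c * cos x - Q / c * sin x) + ((P / c) ^+ 2 + (Q / c) ^+ 2))
     = c + 2 * (P * cos x - Q * sin x) + (X * Y) / c.
    by rewrite -PQ; field; rewrite gt_eqF.
  have -> : X * Y / c = A - c.
    by apply: (mulIf (lt0r_neq0 c0)); rewrite divfK ?gt_eqF// mulrBl -cE; ring.
  rewrite /P /Q /A /X /Y; have := cos2Dsin2 x; move: (cos x) (sin x) => C S CS.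
  transitivity (z1 ^+ 2 + z2 ^+ 2 + (w1 ^+ 2 + w2 ^+ 2) * (C ^+ 2 + S ^+ 2) +
    2 * ((z1 * w1 + z2 * w2) * C - (z1 * w2 - z2 * w1) * S) + dl); first by ring.
  by rewrite CS; ring.
rewrite E circle_avgD.
- rewrite circle_avg_cst jensen// addr0 ler_ln// posrE ?c0//.
  by rewrite ltr_wpDl.
- by move=> x; exact: cvg_cst.
- exact: continuous_ln_sqnorm1D.
Qed.

End complex_norm.

(** * The competitors in the Lelong class *)

Section competitor.
Variables (R : realType) (d : nat).
Implicit Types (z w : 'rV[R[i]]_d) (t : 'rV[R]_d).
Local Open Scope classical_set_scope.
Local Open Scope complex_scope.
Local Notation nC z := (normc z : R).

Lemma continuous_opp_lsc (T : topologicalType) (f : T -> R) :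
  continuous f -> lower_semicontinuous (fun x => - (f x)%:E)%E.
Proof.
move=> cf x a; rewrite -EFinN lte_fin => axf.
have cNf : - f y @[y --> x] --> - f x by apply: cvgN; exact: cf.
exists [set y | a < - f y]; first exact: (cvgr_gt _ cNf).
by move=> y; rewrite /= lte_fin.
Qed.

Lemma continuous_sqnorm_circle (z w : R[i]) :
  continuous (fun x : R => nC (z + w * (cos x +i* sin x)) ^+ 2).
Proof.
case: z w => [z1 z2] [w1 w2].
have -> : (fun x => nC ((z1 +i* z2) + (w1 +i* w2) * (cos x +i* sin x)) ^+ 2) =
  (fun x => (z1 + (w1 * cos x - w2 * sin x)) ^+ 2 +
            (z2 + (w1 * sin x + w2 * cos x)) ^+ 2).
  by apply/funext => x; rewrite sqr_normcE.
move=> x.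
have cs := @continuous_cos R x; have sn := @continuous_sin R x.
by apply: cvgD; apply: (cvg_comp _ (fun y : R => y ^+ 2) _ (@exprn_continuous R 2 _));
  apply: cvgD; try exact: cvg_cst; [apply: cvgB|apply: cvgD];
  apply: cvgM => //; exact: cvg_cst.
Qed.

Definition log_reg (dl : R) (z : R[i]) : R := 2^-1 * ln (nC z ^+ 2 + dl).

(** A smoothing of sum_j t_j ln |z_j| - c that is finite on the coordinate
    hyperplanes. *)
Definition competitor (dl c : R) t z : R :=
  \sum_j t 0 j * log_reg dl (z 0 j) - c.

Lemma log_reg_arg_gt0 (dl : R) (z : R[i]) : 0 < dl -> 0 < nC z ^+ 2 + dl.
Proof. by move=> dl0; rewrite ltr_wpDl// sqr_ge0. Qed.

Lemma continuous_log_reg_comp (T : topologicalType) (dl : R) (f : T -> R[i]) :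
  0 < dl -> continuous (fun x => nC (f x)) -> continuous (fun x => log_reg dl (f x)).
Proof.
move=> dl0 cf x; apply: cvgM; first exact: cvg_cst.
apply: (cvg_comp (fun y => nC (f y) ^+ 2 + dl) (@ln R)); last first.
  by apply: continuous_ln; exact: log_reg_arg_gt0.
apply: cvgD; last exact: cvg_cst.
by apply: (cvg_comp _ (fun y : R => y ^+ 2) _ (@exprn_continuous R 2 _)); exact: cf.
Qed.

Lemma continuous_normc : continuous (fun z : R[i] => nC z).
Proof.
have := @normc_affine_continuous R 0 1.
by under eq_fun do rewrite add0r mulr1.
Qed.

Lemma continuous_competitor_comp (T : topologicalType) dl c t (f : T -> 'rV[R[i]]_d) :
  0 < dl -> (forall j, continuous (fun x => nC (f x 0 j))) ->
  continuous (fun x => competitor dl c t (f x)).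
Proof.
move=> dl0 cf x; apply: cvgB; last exact: cvg_cst.
apply: cvg_big => [|j _]; first exact: add_continuous.
apply: cvgM; first exact: cvg_cst.
exact: continuous_log_reg_comp.
Qed.

Lemma competitor_subharmonic dl c t (a b : 'rV[R[i]]_d) : 0 < dl ->
  (forall j, 0 <= t 0 j) ->
  subharmonic (fun l : R[i] => (competitor dl c t (a + l *: b))%:E).
Proof.
move=> dl0 t0; split=> [|l|l r r0]; last 2 first.
- exact: ltry.
- pose h j x := log_reg dl ((a + l *: b) 0 j + (r%:C * b 0 j) * (cos x +i* sin x)).
  have cl j : continuous (fun x =>
      ln (nC ((a + l *: b) 0 j + (r%:C * b 0 j) * (cos x +i* sin x)) ^+ 2 + dl)).
    apply: continuous_ln_comp => [y|y]; last exact: log_reg_arg_gt0.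
    by apply: cvgD; [exact: continuous_sqnorm_circle|exact: cvg_cst].
  have ch j : continuous (h j).
    by move=> x; apply: cvgM; [exact: cvg_cst|exact: cl].
  pose H x := \sum_j t 0 j * h j x - c.
  have cS j : continuous (fun x => t 0 j * h j x).
    by move=> x; apply: cvgM; [exact: cvg_cst|exact: ch].
  have cS' : continuous (fun x => \sum_j t 0 j * h j x).
    move=> x; apply: cvg_big => [|j _]; first exact: add_continuous.
    exact: cS.
  have cc : continuous (fun _ : R => - c) by move=> x; exact: cvg_cst.
  have cH : continuous H by move=> x; apply: cvgD; [exact: cS'|exact: cc].
  have -> : (fun x => (competitor dl c t (a + (l + r%:C * (cos x +i* sin x)) *: b))%:E)
      = (fun x => (H x)%:E).
    apply/funext => x; congr EFin; congr (_ - _); apply: eq_bigr => j _.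
    by congr (_ * log_reg _ _); rewrite !mxE; ring.
  rewrite integral_circle_avg// lee_fin circle_avgD// circle_avg_cst circle_avg_sum//.
  apply: lerB => //; apply: ler_sum => j _.
  rewrite circle_avgZ//; apply: ler_wpM2l => //.
  rewrite /h /log_reg circle_avgZ//.
  by apply: ler_wpM2l => //; exact: ln_sqnorm_submean.
- apply: continuous_opp_lsc; apply: continuous_competitor_comp => // j.
  have := @normc_affine_continuous R (a 0 j) (b 0 j).
  by under [X in _ -> continuous X]eq_fun do rewrite !mxE.
Qed.

Lemma competitor_psh dl c t : 0 < dl -> (forall j, 0 <= t 0 j) ->
  psh (fun z => (competitor dl c t z)%:E).
Proof.
move=> dl0 t0; split; last by move=> a b; exact: competitor_subharmonic.
- apply: continuous_opp_lsc; apply: continuous_competitor_comp => // j z.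
  apply: (cvg_comp (fun z : 'rV[R[i]]_d => z 0 j) (fun z : R[i] => nC z)).
    exact: continuous_coord.
  exact: continuous_normc.
- by exists 0.
Qed.

Lemma enorm_ge0 z : 0 <= enorm z. Proof. exact: sqrtr_ge0. Qed.

Lemma sqr_enorm z : enorm z ^+ 2 = \sum_j nC (z 0 j) ^+ 2.
Proof. by rewrite sqr_sqrtr// sumr_ge0// => j _; rewrite sqr_ge0. Qed.

Lemma normc_le_enorm z j : nC (z 0 j) <= enorm z.
Proof.
rewrite -(ler_pXn2r (n := 2))// ?nnegrE ?enorm_ge0 ?normc_ge0//.
rewrite sqr_enorm (bigD1 j)//= lerDl sumr_ge0// => k _; exact: sqr_ge0.
Qed.

(** The bound 0 <= L matters since the weights may have sum less than 1. *)
Lemma simplex_sum_le t (f : 'I_d -> R) (L : R) : simplex t -> 0 <= L ->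
  (forall j, f j <= L) -> \sum_j t 0 j * f j <= L.
Proof.
move=> [t0 t1] L0 fL; apply: (@le_trans _ _ (\sum_j t 0 j * L)).
  by apply: ler_sum => j _; exact: ler_wpM2l.
by rewrite -mulr_suml ler_piMl.
Qed.

(** For |z| >= 1, |z_j|^2 + dl <= |z|^2 (1 + dl). *)
Lemma competitor_growth dl c t z : 0 < dl -> simplex t -> 1 <= enorm z ->
  competitor dl c t z <= ln (enorm z) + (2^-1 * ln (1 + dl) - c).
Proof.
move=> dl0 tS z1; rewrite addrA; apply: lerB => //.
have l0 : 0 <= ln (enorm z) by exact: ln_ge0.
have l1 : 0 <= ln (1 + dl) by apply: ln_ge0; lra.
apply: simplex_sum_le => // [|j]; first by lra.
have -> : ln (enorm z) + 2^-1 * ln (1 + dl) = 2^-1 * ln (enorm z ^+ 2 * (1 + dl)).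
  have z0 : 0 < enorm z by exact: lt_le_trans z1.
  rewrite lnM ?posrE ?exprn_gt0//; last lra.
  by rewrite lnXn// mulrDr -(mulr_natl (ln (enorm z))) mulrA mulVf ?mul1r.
apply: ler_wpM2l => //; rewrite ler_ln ?posrE ?log_reg_arg_gt0//; last first.
  by rewrite mulr_gt0 ?exprn_gt0//; lra.
have n0 := normc_ge0 (z 0 j); have n1 := normc_le_enorm z j.
have n2 : nC (z 0 j) ^+ 2 <= enorm z ^+ 2 by rewrite lerXn2r ?nnegrE ?enorm_ge0.
have e2 : 1 <= enorm z ^+ 2 by rewrite exprn_ege1.
rewrite mulrDr mulr1; apply: lerD => //.
by rewrite ler_peMl// ltW.
Qed.

Lemma competitor_lelong dl c t : 0 < dl -> simplex t ->
  lelong (fun z => (competitor dl c t z)%:E).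
Proof.
move=> dl0 tS; split; first by apply: competitor_psh => //; exact: tS.1.
exists (2^-1 * ln (1 + dl) - c), 1 => z z1; rewrite lee_fin.
apply: (le_trans (competitor_growth _ dl0 tS z1)).
by rewrite lerD2r le_max lexx orbT.
Qed.

End competitor.

(** * The transform lies below the extremal function *)

Section weight.
Variables (R : realType) (d : nat) (Q : 'rV[R[i]]_d -> R).
Local Open Scope classical_set_scope.
Local Open Scope complex_scope.
Local Notation nC z := (normc z : R).
Implicit Types (z : 'rV[R[i]]_d) (t s x : 'rV[R]_d).

Definition real_row x : 'rV[R[i]]_d := \row_j (x 0 j)%:C.

Hypothesis Q_C2 : C2 Q.
Hypothesis Q_torus : torus_invariant Q.

Lemma Q_normc z : Q z = Q (real_row (\row_j nC (z 0 j))).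
Proof. by rewrite Q_torus; congr Q; apply/rowP => j; rewrite !mxE normr_normc. Qed.

Lemma continuous_Q_real : continuous (Q \o real_row).
Proof.
have [cQ _] := Q_C2.
have -> : Q \o real_row = (Q \o @of_xy R d) \o (fun x => row_mx x 0).
  by apply/funext => x /=; congr Q; apply/rowP => j; rewrite mxE [RHS]mxE row_mxEl row_mxEr mxE.
move=> x; apply: continuous_comp; last exact: cQ.
apply: continuous_row => j; case: (split_ordP j) => k ->.
  under eq_fun do rewrite row_mxEl; exact: continuous_coord.
have -> : (fun y : 'rV[R]_d => row_mx y (0 : 'rV[R]_d) 0 (rshift d k)) = (fun=> 0).
  by apply/funext => y; rewrite row_mxEr mxE.
exact: cst_continuous.
Qed.

(** Uniform continuity of Q on a compact box, in the variables |z_j| and dl jointly,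
    at dl = 0. *)
Lemma Q_regularized (M eta : R) : 0 < eta ->
  exists2 dl : R, 0 < dl <= 1 & forall z, (forall j, nC (z 0 j) <= M) ->
    Q (real_row (\row_j Num.sqrt (nC (z 0 j) ^+ 2 + dl))) <= Q z + eta.
Proof.
move=> eta0.
pose K := [set x : 'rV[R]_d | forall j, (`[0, M] : set R) (x ord0 j)].
have cK : compact K.
  by apply: (@rV_compact R d (fun=> `[0, M])) => j; exact: segment_compact.
pose G := Q \o real_row.
pose S (p : 'rV[R]_d * R) : 'rV[R]_d := \row_j Num.sqrt (p.1 0 j ^+ 2 + p.2).
have cS : continuous S.
  apply: continuous_row => j; under eq_fun do rewrite mxE.
  move=> p; apply: continuous_comp; last exact: sqrt_continuous.
  apply: cvgD; last exact: cvg_snd.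
  apply: (cvg_comp _ (fun y : R => y ^+ 2) _ (@exprn_continuous R 2 _)).
  apply: (cvg_comp _ (fun y : 'rV[R]_d => y 0 j) _ (@continuous_coord _ _ j _)).
  exact: cvg_fst.
have cG : continuous (fun p => G (S p) - G p.1).
  move=> p; apply: cvgB.
    by apply: continuous_comp; [exact: cS|exact: continuous_Q_real].
  by apply: continuous_comp; [exact: cvg_fst|exact: continuous_Q_real].
have /compact_near_coveringP cov := cK.
have /nbhs_ballP : \forall e \near (0 : R), K `<=` [set x | G (S (x, e)) - G x < eta].
  apply: (cov R (nbhs (0 : R)) (fun e x => G (S (x, e)) - G x < eta)) => x Kx.
  have G0 : G (S (x, 0)) - G (x, (0 : R)).1 = 0.
    apply/eqP; rewrite subr_eq0; apply/eqP; congr G; apply/rowP => j; rewrite mxE /=.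
    rewrite addr0 sqrtr_sqr ger0_norm//.
    by have := Kx j; rewrite /= in_itv => /andP[].
  by apply: (cvgr_lt _ (cG (x, 0))); rewrite G0.
move=> [_/posnumP[e]] eK.
pose dl := Num.min 1 (e%:num / 2).
have dl0 : 0 < dl by rewrite lt_min ltr01/=.
exists dl; first by rewrite dl0 ge_min lexx.
move=> z zM.
have Kz : K (\row_j nC (z 0 j)).
  by move=> j; rewrite /= in_itv/= mxE zM normc_ge0.
have /eK /(_ _ Kz) : ball 0 e%:num dl.
  rewrite /ball/= sub0r normrN gtr0_norm// /dl gt_min; apply/orP; right.
  by rewrite ltr_pdivrMr// ltr_pMr// ltr1n.
rewrite /= ltrBlDr => /ltW; rewrite /G /= -Q_normc addrC.
rewrite (_ : S _ = \row_j Num.sqrt (nC (z 0 j) ^+ 2 + dl))//.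
by apply/rowP => j; rewrite !mxE.
Qed.


Lemma expR_half_ln (y : R) : 0 < y -> expR (2^-1 * ln y) = Num.sqrt y.
Proof.
move=> y0; apply/eqP; rewrite -(eqrXn2 (n := 2))// ?expR_ge0 ?sqrtr_ge0//.
rewrite sqr_sqrtr ?ltW// expr2 -expRD -mulrDl (_ : 2^-1 + 2^-1 = 1 :> R); last lra.
by rewrite mul1r lnK.
Qed.

Lemma competitorE dl c t z :
  competitor dl c t z = dotr t (\row_j log_reg dl (z 0 j)) - c.
Proof.
by congr (_ - _); apply: eq_bigr => j _; rewrite mxE.
Qed.

Hypothesis Q_growth : exists eps R0 : R, [/\ 0 < eps, 0 < R0 &
  forall z, R0 <= enorm z -> (1 + eps) * ln (enorm z) <= Q z].

(** In the ball of radius M, the competitor is <t, s> - U - eta at the point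
    s_j = 1/2 ln (|z_j|^2 + dl), and q(s) <= Q z + eta.  Outside, the factor 1 + eps
    in the growth of Q absorbs the constants once eps ln M is large enough; U is at
    least - q(0), whatever t is. *)
Lemma competitor_le_Q (eta : R) : 0 < eta -> exists2 dl : R, 0 < dl &
  forall t (U : R), simplex t -> (forall s, dotr t s - q_of Q s <= U) ->
    forall z, competitor dl (U + eta) t z <= Q z.
Proof.
move=> eta0; have [eps [R0 [eps0 R00 Qg]]] := Q_growth.
(* eps * M1 dominates ln (1 + dl) / 2 - U, since U >= - q 0. *)
pose M1 := (2^-1 * ln 2 + `|q_of Q 0|) / eps.
pose M := Num.max R0 (Num.max 1 (expR M1)).
have [dl /andP[dl0 dl1] Qdl] := Q_regularized M eta0.
exists dl => // t U tS tU z.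
have [zM|Mz] := leP (enorm z) M.
  have zjM j : nC (z 0 j) <= M by exact: le_trans (normc_le_enorm _ _) zM.
  rewrite competitorE; set s := \row_j _.
  have qs : q_of Q s <= Q z + eta.
    apply: le_trans (Qdl _ zjM); rewrite le_eqVlt; apply/orP; left; apply/eqP.
    congr Q; apply/rowP => j; rewrite !mxE expR_half_ln//.
    exact: log_reg_arg_gt0.
  by have := tU s; lra.
have [MR M1M] : R0 <= M /\ expR M1 <= M by split; rewrite !le_max lexx ?orbT.
have M1' : 1 <= M by rewrite !le_max lexx orbT.
have z1 : 1 <= enorm z by rewrite (le_trans M1')// ltW.
have zR0 : R0 <= enorm z by rewrite (le_trans MR)// ltW.
have lz : M1 <= ln (enorm z).
  rewrite -[M1]expRK ler_ln ?posrE ?expR_gt0//; last by apply: lt_le_trans z1.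
  by rewrite (le_trans M1M)// ltW.
apply: le_trans (competitor_growth _ dl0 tS z1) _.
apply: le_trans (Qg _ zR0).
have := tU 0; rewrite /dotr big1 => [|j _]; last by rewrite mxE mulr0.
have l2 : ln (1 + dl) <= ln 2 by rewrite ler_ln ?posrE//; lra.
move: lz; rewrite /M1 ler_pdivrMr// => lz.
have := ler_norm (q_of Q 0); rewrite mulrDl mul1r; lra.
Qed.

Lemma lne_f_of t : lne (f_of Q t) = (- u_of Q t)%E.
Proof. by rewrite /f_of expeRK. Qed.

(** The choice of dl and of the neighbourhood A of z is uniform in t: the weights
    sum to at most 1, so the value of v_t at a point of A exceeds that of the
    competitor at z by at most e. *)
Lemma Phi_le_weighted_extremal z :
  (Phi (@simplex R d) (f_of Q) z <= weighted_extremal Q z)%E.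
Proof.
apply/lee_addgt0Pr => e e0.
have e20 : 0 < e / 2 by rewrite divr_gt0.
have [dl dl0 wQ] := competitor_le_Q e20.
pose A := [set zeta : 'rV[R[i]]_d | Cstar zeta /\
  forall j, log_reg dl (zeta 0 j) < log_reg dl (z 0 j) + e / 2].
have FA : within (@Cstar R d) (nbhs z) A.
  have : \forall zeta \near z, forall j, log_reg dl ((zeta : 'rV[R[i]]_d) 0 j) < log_reg dl (z 0 j) + e / 2.
    apply: (@filter_forall _ _ (fun j (zeta : 'rV[R[i]]_d) =>
      log_reg dl (zeta 0 j) < log_reg dl (z 0 j) + e / 2) (nbhs z)) => j.
    have cl : continuous (fun x : 'rV[R[i]]_d => log_reg dl (x 0 j)).
      apply: continuous_log_reg_comp => // x.
      apply: (cvg_comp (fun z : 'rV[R[i]]_d => z 0 j) (fun z : R[i] => nC z)).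
        exact: continuous_coord.
      exact: continuous_normc.
    by apply: (cvgr_lt _ (cl z)); rewrite ltrDl.
  by apply: filterS => zeta h Cz; split.
apply: (@le_trans _ _ (ereal_sup ((fun zeta => Ifun (@simplex R d) (f_of Q) (Log zeta)) @` A))).
  by apply: ereal_inf_lbound; exists A.
apply: ge_ereal_sup => _ [zeta [Cz zA] <-].
apply: ge_ereal_sup => _ [t tS <-]; rewrite lne_f_of.
case Eu : (u_of Q t) => [U| |].
- have tU s : dotr t s - q_of Q s <= U.
    by rewrite -lee_fin -Eu; apply: ereal_sup_ubound; exists s.
  apply: (@le_trans _ _ ((competitor dl (U + e / 2) t z)%:E + e%:E)%E); last first.
    apply: leeD => //; apply: ereal_sup_ubound.
    exists (fun y : 'rV[R[i]]_d => (competitor dl (U + e / 2) t y)%:E) => //; split.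
      exact: competitor_lelong.
    by move=> x; rewrite lee_fin; exact: wQ.
  rewrite -!EFinD lee_fin.
  have : \sum_j t 0 j * (ln (nC (zeta 0 j)) - log_reg dl (z 0 j)) <= e / 2.
    apply: simplex_sum_le => // [|j]; first exact: ltW.
    have l0 : 0 < nC (zeta 0 j) by rewrite normc_gt0; exact: Cz.
    have : ln (nC (zeta 0 j)) <= log_reg dl (zeta 0 j).
      have -> : ln (nC (zeta 0 j)) = 2^-1 * ln (nC (zeta 0 j) ^+ 2).
        by rewrite lnXn// -(mulr_natl (ln (nC (zeta 0 j)))) mulrA mulVf ?mul1r.
      by apply: ler_wpM2l => //; rewrite ler_ln ?posrE ?exprn_gt0 ?log_reg_arg_gt0// lerDl ltW.
    have := zA j; lra.
  under eq_bigr do rewrite mulrBr; rewrite sumrB.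
  have -> : dotr (Log zeta) t = \sum_j t 0 j * ln (nC (zeta 0 j)).
    by apply: eq_bigr => j _; rewrite mxE mulrC.
  rewrite /competitor; lra.
- by rewrite /= leNye.
- have : ((dotr t 0 - q_of Q 0)%:E <= u_of Q t)%E by apply: ereal_sup_ubound; exists 0.
  by rewrite Eu.
Qed.

End weight.

(** * Semicontinuity, the unit torus and subgradients *)

Section usc.
Variable R : realType.
Local Open Scope classical_set_scope.
Local Open Scope ereal_scope.

Lemma lte_EFin_between (x : \bar R) (c : R) : x < c%:E ->
  exists2 c' : R, x < c'%:E & (c' < c)%R.
Proof.
case: x => [r|//|_]; last by exists (c - 1)%R; [exact: ltNyr|lra].
rewrite lte_fin => rc; exists ((r + c) / 2)%R; last lra.
by rewrite lte_fin; lra.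
Qed.

(** If the supremum S were not attained, every point would have a neighbourhood
    on which F stays below a real number less than S, and by compactness one such
    number would bound F. *)
Lemma usc_compact_max (X : topologicalType) (K : set X) (F : X -> \bar R) :
  compact K -> K !=set0 ->
  (forall x (c : R), K x -> F x < c%:E -> \forall y \near x, F y < c%:E) ->
  exists2 p, K p & forall x, K x -> F x <= F p.
Proof.
move=> /compact_near_coveringP cov [x0 Kx0] uscF.
have [[p [Kp pS]]|noS] :=
    pselect (exists p, K p /\ ereal_sup [set F x | x in K] <= F p).
  exists p => // x Kx; apply: le_trans pS.
  by apply: ereal_sup_ubound; exists x.
have ltS x : K x -> F x < ereal_sup [set F x | x in K].
  by move=> Kx; rewrite ltNge; apply/negP => ?; apply: noS; exists x.
have contra (c : R) : c%:E < ereal_sup [set F x | x in K] ->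
    K `<=` [set x | F x < c%:E] -> False.
  move=> cS Kc; move: cS; rewrite ltNge => /negP; apply.
  by apply: ge_ereal_sup => _ [x Kx <-]; exact/ltW/Kc.
exfalso; case ES : (ereal_sup [set F x | x in K]) => [S| |]; last by have := ltS _ Kx0; rewrite ES ltNge leNye.
- have : \forall c \near S^'-, K `<=` [set x | F x < c%:E].
    apply: (cov R S^'- (fun c x => F x < c%:E)) => x Kx.
    have := ltS x Kx; rewrite ES => /lte_EFin_between[c Fc cS].
    exists ([set y | F y < c%:E], [set c' | c < c']%R) => /=.
      by split; [exact: uscF|exact: nbhs_left_gt].
    by move=> [y c'] /= [Fy cc']; apply: (lt_trans Fy); rewrite lte_fin.
  have ltS' : \forall c \near S^'-, (c < S)%R by exact: nbhs_left_lt.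
  move=> /(filterI ltS') /filter_ex [c [cS]]; apply: contra.
  by rewrite ES lte_fin.
- have : \forall c \near +oo%R, K `<=` [set x | F x < c%:E].
    apply: (cov R (+oo%R : set_system R) (fun c x => F x < c%:E)) => x Kx.
    have := ltS x Kx; rewrite ES => Fx.
    have [c Fc] : exists c : R, F x < c%:E.
      case: (F x) Fx => [r _|//|_]; last by exists 0%R; exact: ltNyr.
      by exists (r + 1)%R; rewrite lte_fin; lra.
    exists ([set y | F y < c%:E], [set c' | c < c']%R) => /=.
      by split; [exact: uscF|by exists c; split => //; exact: num_real].
    by move=> [y c'] /= [Fy cc']; apply: (lt_trans Fy); rewrite lte_fin.
  by move=> /filter_ex [c]; apply: contra; rewrite ES ltry.
Qed.

Lemma usc_near_lt (X : topologicalType) (v : X -> \bar R) x (c : R) :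
  lower_semicontinuous (\- v) -> v x < c%:E -> \forall y \near x, v y < c%:E.
Proof.
move=> lsc vc; have [V Vx Vc] : exists2 V, nbhs x V & forall y, V y -> (- c)%:E < - v y.
  by apply: lsc; rewrite EFinN lteN2.
by apply: filterS Vx => y /Vc; rewrite EFinN lteN2.
Qed.

End usc.

Section torus.
Variables (R : realType) (d : nat).
Local Open Scope classical_set_scope.
Local Open Scope complex_scope.
Local Notation nC z := (normc z : R).

Definition torus : set 'rV[R[i]]_d := [set om | forall j, nC (om 0 j) = 1].

Lemma unit_circle_param (z : R[i]) : nC z = 1 ->
  exists2 x : R, - pi <= x <= pi & z = cos x +i* sin x.
Proof.
move=> z1; have : nC z ^+ 2 = 1 by rewrite z1 expr1n.
rewrite sqr_normcE; case: z z1 => a b _ /= ab.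
have a1 : -1 <= a <= 1 by apply/andP; split; nra.
have s1 : Num.sqrt (1 - a ^+ 2) = `|b| by rewrite -ab addrC addKr sqrtr_sqr.
have ge0 : 0 <= acos a by exact: acos_ge0.
have lepi : acos a <= pi by exact: acos_lepi.
have pi0 := pi_ge0 R.
have [b0|b0] := leP 0 b.
  exists (acos a); first by apply/andP; split; lra.
  by rewrite acosK// sin_acos// s1 ger0_norm.
exists (- acos a); first by apply/andP; split; lra.
by rewrite cosN sinN acosK// sin_acos// s1 ltr0_norm// opprK.
Qed.

Lemma continuous_cis : continuous (fun x : R => cos x +i* sin x).
Proof.
move=> x A /nbhs_complexP[e e0 eA].
have e20 : 0 < e / 2 by rewrite divr_gt0.
have c : \forall y \near x, `|cos x - cos y| < e / 2.
  by have /cvgrPdist_lt /(_ _ e20) := @continuous_cos R x.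
have s : \forall y \near x, `|sin x - sin y| < e / 2.
  by have /cvgrPdist_lt /(_ _ e20) := @continuous_sin R x.
apply: filterS2 c s => y; rewrite !ltr_norml => /andP[c1 c2] /andP[s1 s2].
apply: eA; rewrite -(ltr_pXn2r (n := 2))// ?nnegrE ?normc_ge0 ?ltW//.
by rewrite sqr_normcE /=; nra.
Qed.

Lemma torus_compact : compact torus.
Proof.
apply: (@rV_compact _ d (fun=> [set z : R[i] | nC z = 1])) => _.
have -> : [set z : R[i] | nC z = 1] = (fun x : R => cos x +i* sin x) @` `[- pi, pi].
  apply/seteqP; split => [z /unit_circle_param[x xpi ->]|_ [x _ <-]] /=.
    by exists x => //=; rewrite in_itv.
  by rewrite cos2Dsin2 sqrtr1.
apply: continuous_compact; last exact: segment_compact.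
by apply: continuous_subspaceT; exact: continuous_cis.
Qed.

End torus.

Section subgradient.
Variables (R : realType) (d : nat) (G : 'rV[R]_d -> R).
Implicit Types (t s v : 'rV[R]_d) (k : R).
Hypothesis convG : forall s1 s2 (la : R), 0 <= la <= 1 ->
  G (s1 + la *: (s2 - s1)) <= G s1 + la * (G s2 - G s1).

Lemma dotrDl t t' s : dotr (t + t') s = dotr t s + dotr t' s :> R.
Proof. by rewrite -big_split; apply: eq_bigr => j _; rewrite mxE mulrDl. Qed.
Lemma dotrDr t s s' : dotr t (s + s') = dotr t s + dotr t s' :> R.
Proof. by rewrite -big_split; apply: eq_bigr => j _; rewrite mxE mulrDr. Qed.
Lemma dotrZr t k s : dotr t (k *: s) = k * dotr t s :> R.
Proof. by rewrite mulr_sumr; apply: eq_bigr => j _; rewrite mxE mulrCA. Qed.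
Lemma dotrZl t k s : dotr (k *: t) s = k * dotr t s :> R.
Proof. by rewrite mulr_sumr; apply: eq_bigr => j _; rewrite mxE mulrA. Qed.
Lemma dotr_deltal (j : 'I_d) s : dotr (delta_mx 0 j) s = s 0 j :> R.
Proof.
rewrite /dotr (bigD1 j)//= mxE !eqxx mul1r big1 ?addr0// => k /negbTE kj.
by rewrite mxE eqxx kj mul0r.
Qed.
Lemma dotr_deltar (j : 'I_d) t : dotr t (delta_mx 0 j) = t 0 j :> R.
Proof.
rewrite /dotr (bigD1 j)//= mxE !eqxx mulr1 big1 ?addr0// => k /negbTE kj.
by rewrite mxE eqxx kj mulr0.
Qed.

(** The functional is extended one coordinate at a time: on the points that differ
    from s0 only in the first k coordinates, the slopes to the left and to the right
    in the next direction e are separated by convexity, so a number b lies in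
    between. *)
Lemma subgradient s0 : exists t, forall s, G s0 + dotr t (s - s0) <= G s.
Proof.
suff sub (k : nat) : (k <= d)%N -> exists t : 'rV[R]_d, (forall j : 'I_d, (k <= j)%N -> t 0 j = 0) /\
    forall v, (forall j : 'I_d, (k <= j)%N -> v 0 j = 0) ->
    G s0 + dotr t v <= G (s0 + v).
  have [t [_ tG]] := sub d (leqnn d); exists t => s.
  have := tG (s - s0); rewrite [s0 + _]addrC subrK; apply => j.
  by rewrite leqNgt ltn_ord.
elim: k => [_|k IH kd].
  exists 0; split=> [j|v v0]; first by rewrite mxE.
  have -> : v = 0 by apply/rowP => j; rewrite mxE v0.
  by rewrite addr0 /dotr big1 ?addr0// => j _; rewrite mxE mulr0.
have [t [t0 tG]] := IH (ltnW kd).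
pose jk := Ordinal kd; pose e : 'rV[R]_d := delta_mx 0 jk.
pose V := [set v : 'rV[R]_d | forall j : 'I_d, (k <= j)%N -> v 0 j = 0]%classic.
pose Dlt v (h : R) := G (s0 + v + h *: e) - G s0 - dotr t v.
have key v v' (h h' : R) : V v -> V v' -> 0 < h -> 0 < h' ->
    - Dlt v' (- h') / h' <= Dlt v h / h.
  move=> Vv Vv' h0 h'0.
  have hh : 0 < h + h' by rewrite addr_gt0.
  pose la := h / (h + h').
  have la01 : 0 <= la <= 1.
    apply/andP; split; first by rewrite divr_ge0 ?ltW.
    by rewrite ler_pdivrMr// mul1r lerDl ltW.
  have := convG (s0 + v + h *: e) (s0 + v' + (- h') *: e) la01.
  pose v'' := v + la *: (v' - v).
  have -> : s0 + v + h *: e + la *: (s0 + v' + - h' *: e - (s0 + v + h *: e)) = s0 + v''.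
    apply/rowP => j; rewrite !mxE /la.
    by field; rewrite gt_eqF.
  have : V v'' by move=> j kj; rewrite !mxE Vv// Vv'// subrr mulr0 addr0.
  move=> /tG; rewrite dotrDr dotrZr dotrDr -scaleN1r dotrZr => A B.
  have laE : la * (h + h') = h by rewrite /la divfK// gt_eqF.
  have mulE (X Y : R) : (X + la * Y) * (h + h') = X * (h + h') + h * Y.
    by rewrite mulrDl mulrAC laE.
  have := ler_wpM2r (ltW hh) (le_trans A B); rewrite addrA !mulE.
  rewrite ler_pdivrMr// mulrAC ler_pdivlMr// /Dlt.
  move: (G _) (G _) (G s0) (dotr t v) (dotr t v') => g1 g2 g0 d1 d2.
  nra.
have V0 : V 0 by move=> j _; rewrite mxE.
(* the slopes at s0 to the left in the direction e; by key they lie below those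
   to the right *)
pose L := [set x | exists v h, [/\ V v, 0 < h & x = - Dlt v (- h) / h]]%classic.
have supL : has_sup L.
  split; first by exists (- Dlt 0 (- 1) / 1), 0, 1.
  exists (Dlt 0 1 / 1) => _ [v [h [Vv h0 ->]]]; exact: key.
pose b := sup L.
have bL v (h : R) : V v -> 0 < h -> - Dlt v (- h) <= b * h.
  move=> Vv h0; rewrite -ler_pdivrMr//; apply: (ub_le_sup supL.2).
  by exists v, h.
have bU v (h : R) : V v -> 0 < h -> b * h <= Dlt v h.
  move=> Vv h0; rewrite -ler_pdivlMr//; apply: (ge_sup supL.1).
  by move=> _ [v' [h' [Vv' h'0 ->]]]; exact: key.
exists (t + b *: e); split=> [j kj|v v0].
  rewrite !mxE t0 1?ltnW// eqxx /= (_ : (j == jk) = false) ?mulr0 ?addr0//.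
  by apply/negP => /eqP jE; move: kj; rewrite jE ltnn.
pose h := v 0 jk; pose v' := v - h *: e.
have vE : v = v' + h *: e by rewrite subrK.
have Vv' : V v'.
  move=> j kj; rewrite !mxE eqxx /=; case: eqVneq => [->|jn].
    by rewrite mulr1 subrr.
  rewrite mulr0 subr0 v0// ltn_neqAle kj andbT; apply: contra jn => /eqP kE.
  by apply/eqP/val_inj.
rewrite dotrDl dotrZl dotr_deltal -/h.
have -> : dotr t v = dotr t v'.
  by rewrite [in LHS]vE dotrDr dotrZr dotr_deltar t0// mulr0 addr0.
rewrite [in leRHS]vE (addrA s0); clearbody h v'; case: (ltgtP 0 h) => h0.
- by have := bU v' h Vv' h0; rewrite /Dlt; lra.
- have := bL v' (- h) Vv'; rewrite oppr_gt0 => /(_ h0); rewrite /Dlt opprK; lra.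
- by rewrite -h0 mulr0 scale0r !addr0; exact: tG.
Qed.

End subgradient.

(** * Plurisubharmonic functions in logarithmic coordinates *)

Section psh_basics.
Variables (R : realType) (d : nat) (w : 'rV[R[i]]_d -> \bar R).
Hypothesis psh_w : psh w.
Local Open Scope classical_set_scope.
Local Open Scope complex_scope.
Local Notation nC z := (normc z : R).
Implicit Types (s a e y : 'rV[R]_d) (om z b : 'rV[R[i]]_d).

Lemma psh_usc z (c : R) : (w z < c%:E)%E -> \forall z' \near z, (w z' < c%:E)%E.
Proof. by move=> wc; apply: usc_near_lt => //; case: psh_w. Qed.

Lemma psh_lty z : (w z < +oo)%E.
Proof.
have [_ _ /(_ z 0)[_ /(_ 0)]] := psh_w.
by rewrite scaler0 addr0.
Qed.

(** The circle of radius 1 in direction b; the radius is carried by b. *)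
Lemma psh_submean z b (h : R -> R) : continuous h ->
  (forall x, (w (z + (cos x +i* sin x)%C *: b) <= (h x)%:E)%E) ->
  (w z <= (circle_avg h)%:E)%E.
Proof.
move=> ch wh; have [_ _ /(_ z b)[_ _ /(_ 0 1 ltr01)]] := psh_w.
rewrite scale0r addr0 => /le_trans; apply.
apply: integral_le_circle_avg => // x.
by rewrite add0r rmorph1 mul1r.
Qed.

(** The point with logarithmic moduli s and arguments om. *)
Definition polar s om : 'rV[R[i]]_d := \row_j ((expR (s 0 j))%:C * om 0 j).

(** The first-order expansion of ln |1 + k e^(ix)| at k = 0. *)
Lemma log_modulus_estimate (k x : R) : `|k| <= 8^-1 ->
  `|2^-1 * ln (sqnorm1D k 0 x) - k * cos x| <= 9 * k ^+ 2.
Proof.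
move=> k8; rewrite /sqnorm1D mul0r subr0 expr0n addr0.
have : `|k * cos x| <= `|k|.
  by rewrite normrM ler_piMr// ler_norml cos_geN1 cos_le1.
have k0 := normr_ge0 k; rewrite -(real_normK (num_real k)).
move: k0 k8 (k * cos x) => + + c; move: (`|k|) => K K0 K8.
rewrite ler_norml => /andP[c1 c2].
set v := 2 * c + K ^+ 2.
have -> : 1 + 2 * c + K ^+ 2 = 1 + v by rewrite /v addrA.
have v1 : - (3 * K) <= v <= 3 * K by rewrite /v; apply/andP; split; nra.
have /andP[v1l v1r] := v1.
have v12 : - 2^-1 <= v by lra.
have v9 : v ^+ 2 <= 9 * K ^+ 2 by nra.
have up : ln (1 + v) <= v.
  have v1' : 0 < 1 + v by lra.
  have := expR_ge1Dx (ln (1 + v)); rewrite lnK ?posrE//; lra.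
have lo : v - 2 * v ^+ 2 <= ln (1 + v).
  have v1' : 0 < 1 + v by lra.
  have := expR_ge1Dx (- ln (1 + v)); rewrite expRN lnK ?posrE// => h.
  have : (1 + v)^-1 <= 1 - v + 2 * v ^+ 2.
    by rewrite -[leLHS]mul1r ler_pdivrMr//; nra.
  lra.
have K20 : 0 <= K ^+ 2 by exact: sqr_ge0.
have cE : 2 * c = v - K ^+ 2 by rewrite /v; ring.
clearbody v.
rewrite ler_norml; apply/andP; split; lra.
Qed.

(** On the circle of radius rho in the complex line z_j (1 + l a_j), the logarithmic
    moduli move by ln |1 + rho a_j e^(ix)|. *)
Lemma polar_circle s om a (rho x : R) : torus om ->
  (forall j, (rho * a 0 j) ^+ 2 < 1) ->
  let l j := 2^-1 * ln (sqnorm1D (rho * a 0 j) 0 x) in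
  exists2 om', torus om' &
    polar s om + (cos x +i* sin x)%C *: (\row_j ((rho * a 0 j)%:C * polar s om 0 j)) =
    polar (s + \row_j l j) om'.
Proof.
move=> Tom k1 l.
have g0 j : 0 < sqnorm1D (rho * a 0 j) 0 x.
  by apply: sqnorm1D_gt0; rewrite expr0n addr0.
pose f j : R[i] := 1 + (rho * a 0 j)%:C * (cos x +i* sin x).
have fE j : nC (f j) = expR (l j).
  rewrite expR_half_ln//; apply/eqP; rewrite -(eqrXn2 (n := 2))// ?normc_ge0 ?sqrtr_ge0//.
  rewrite sqr_normcE sqr_sqrtr ?ltW// /f /sqnorm1D /=.
  have := cos2Dsin2 x; move: (cos x) (sin x) (rho * a 0 j) => C S k CS.
  apply/eqP; transitivity (1 + 2 * (k * C) + k ^+ 2 * (C ^+ 2 + S ^+ 2)); first by ring.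
  by rewrite CS; ring.
exists (\row_j (om 0 j * f j * ((expR (l j))^-1)%:C)) => [j|].
  rewrite mxE !normcM normc_real fE Tom mul1r ger0_norm ?invr_ge0 ?expR_ge0//.
  by rewrite divff// gt_eqF// expR_gt0.
apply/rowP => j; rewrite !mxE expRD rmorphM /=.
have E : (expR (l j))%:C * ((expR (l j))^-1)%:C = 1 :> R[i].
  by rewrite -rmorphM /= divff ?gt_eqF ?expR_gt0.
transitivity ((expR (s 0 j))%:C * om 0 j * f j * ((expR (l j))%:C * ((expR (l j))^-1)%:C)).
  by rewrite E /f; ring.
by ring.
Qed.

(** A is a bound for the a_j; the last condition makes the quartic error smaller
    than the quadratic gain. *)
Lemma small_radius (r0 c2 A N : R) : 0 < r0 -> 0 < c2 -> 1 <= A -> 0 <= N ->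
  exists rho, [/\ 0 < rho, rho < r0, rho * A <= 8^-1,
    9 * (rho * A) ^+ 2 < r0 & N * (9 * (rho * A) ^+ 2) ^+ 2 < 2^-1 * (c2 * rho ^+ 2)].
Proof.
move=> r00 c20 A1 N0.
have A0 : 0 < A by lra.
pose m := Num.min 8^-1 (Num.min (r0 / 10) (c2 / (4 * (81 * (N * A ^+ 2) + 1)))).
have NA : 0 <= N * A ^+ 2 by rewrite mulr_ge0// sqr_ge0.
have D0 : 0 < 4 * (81 * (N * A ^+ 2) + 1) by lra.
have m0 : 0 < m by rewrite !lt_min divr_gt0// divr_gt0// invr_gt0 ltr0n.
have m1 : m <= 8^-1 by rewrite ge_min lexx.
have m2 : m <= r0 / 10 by rewrite !ge_min lexx orbT.
have m3 : m * (4 * (81 * (N * A ^+ 2) + 1)) <= c2.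
  by rewrite -ler_pdivlMr// !ge_min lexx !orbT.
clearbody m; exists (m / A); have mA : m / A * A = m by rewrite divfK// gt_eqF.
have mAm : m / A <= m by rewrite ler_pdivrMr// ler_peMr// ltW.
have mA0 : 0 < m / A by rewrite divr_gt0.
have E : (9 * m ^+ 2) ^+ 2 = 81 * (m ^+ 2 * A ^+ 2) * (m / A) ^+ 2.
  by rewrite -{1 2}mA; ring.
rewrite mA; split => //; [lra|nra|].
rewrite E; move: (m / A) mA0 {E mA mAm} => q q0.
have q2 : 0 < q ^+ 2 by rewrite exprn_gt0.
suff : N * (81 * (m ^+ 2 * A ^+ 2)) < 2^-1 * c2.
  by rewrite -(ltr_pM2r q2) !mulrA.
have -> : N * (81 * (m ^+ 2 * A ^+ 2)) = 81 * (N * A ^+ 2) * m * m by ring.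
move: (N * A ^+ 2) NA m3 => X X0; nra.
Qed.

(** A plurisubharmonic function is not touched from above, in logarithmic
    coordinates, by a function that is strictly concave in a direction a.  The touching
    function is a polynomial in coordinates (p, e) of s + p a + e, where e need not be
    transversal to a: on the circle with parameter rho, take p = rho cos x and for e_j
    the remainder ln |1 + rho a_j e^(ix)| - rho a_j cos x.  This has mean 0 by
    Jensen's formula and is O(rho^2), so that only - c2 p^2, with mean
    - c2 rho^2 / 2, counts to second order. *)
Lemma no_concave_touch s om a (W c1 c2 N r0 : R) (m : 'I_d -> R) :
  torus om -> w (polar s om) = W%:E -> 0 < c2 -> 0 <= N -> 0 < r0 ->
  (forall p e om', `|p| < r0 -> (forall j, `|e 0 j| < r0) -> torus om' ->
    (w (polar (s + p *: a + e) om') <=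
     (W + c1 * p - c2 * p ^+ 2 + \sum_j (m j * e 0 j + N * (e 0 j) ^+ 2)%R)%:E)%E) ->
  False.
Proof.
move=> Tom wW c20 N0 r00 touch.
pose A := 1 + \sum_j `|a 0 j|.
have aA j : `|a 0 j| <= A.
  rewrite /A (bigD1 j)//= addrCA lerDl addr_ge0// sumr_ge0// => k _; exact: normr_ge0.
have A1 : 1 <= A by rewrite lerDl sumr_ge0// => k _; exact: normr_ge0.
have Nd0 : 0 <= d%:R * N by rewrite mulr_ge0.
have [rho [rho0 rhor0 rhoA8 rhoAr0 small]] := small_radius r00 c20 A1 Nd0.
have kA j : `|rho * a 0 j| <= rho * A.
  by rewrite normrM gtr0_norm// ler_wpM2l// ltW.
have k8 j : `|rho * a 0 j| <= 8^-1 by exact: le_trans (kA j) rhoA8.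
have k2 j : (rho * a 0 j) ^+ 2 <= (rho * A) ^+ 2.
  rewrite -(real_normK (num_real (rho * a 0 j))) lerXn2r// ?nnegrE ?normr_ge0//.
  by rewrite (le_trans _ (kA j)).
have k1 j : (rho * a 0 j) ^+ 2 < 1.
  rewrite -(real_normK (num_real (rho * a 0 j))).
  have := k8 j; have := normr_ge0 (rho * a 0 j); move: `|_| => k k0 kk; nra.
pose l j x := 2^-1 * ln (sqnorm1D (rho * a 0 j) 0 x).
pose e j x := l j x - rho * a 0 j * cos x.
(* a common bound for the remainders e_j *)
pose E := 9 * (rho * A) ^+ 2.
have E0 : 0 <= E by rewrite mulr_ge0// sqr_ge0.
have eE j x : `|e j x| <= E.
  apply: le_trans (log_modulus_estimate x (k8 j)) _.
  by rewrite /E ler_wpM2l.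
have s1 j : (rho * a 0 j) ^+ 2 + 0 ^+ 2 < 1 by rewrite expr0n addr0.
have cl j : continuous (l j).
  move=> x; apply: cvgM; first exact: cvg_cst.
  exact: (continuous_ln_sqnorm1D (s1 j)).
have ckc (k : R) : continuous (fun x : R => k * cos x).
  by move=> x; apply: cvgM; [exact: cvg_cst|exact: continuous_cos].
have ckc2 (k : R) : continuous (fun x : R => k * cos x ^+ 2).
  move=> x; apply: cvgM; first exact: cvg_cst.
  by apply: (cvg_comp _ (fun y : R => y ^+ 2) _ (@exprn_continuous R 2 _)); exact: continuous_cos.
have ce j : continuous (e j).
  by move=> x; apply: cvgB; [exact: cl|exact: ckc].
have cme j : continuous (fun x => m j * e j x).
  by move=> x; apply: cvgM; [exact: cvg_cst|exact: ce].
have cS : continuous (fun x => \sum_j m j * e j x).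
  by move=> x; apply: cvg_big => [|j _]; [exact: add_continuous|exact: cme].
pose K := W + d%:R * (N * E ^+ 2).
have cK : continuous (fun _ : R => K) by move=> x; exact: cvg_cst.
pose h x := K + (c1 * rho * cos x + (- (c2 * rho ^+ 2) * cos x ^+ 2 + \sum_j m j * e j x)).
have c3 : continuous (fun x => - (c2 * rho ^+ 2) * cos x ^+ 2 + \sum_j m j * e j x).
  by move=> x; apply: cvgD; [exact: ckc2|exact: cS].
have c4 : continuous (fun x => c1 * rho * cos x + (- (c2 * rho ^+ 2) * cos x ^+ 2 + \sum_j m j * e j x)).
  by move=> x; apply: cvgD; [exact: ckc|exact: c3].
have ch : continuous h by move=> x; apply: cvgD; [exact: cK|exact: c4].
have ccos : continuous (@cos R) by exact: continuous_cos.
have avge j : circle_avg (e j) = 0.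
  rewrite (_ : e j = fun x => 2^-1 * ln (sqnorm1D (rho * a 0 j) 0 x) + - (rho * a 0 j) * cos x).
    rewrite circle_avgD//.
    - rewrite !circle_avgZ//; last exact: (continuous_ln_sqnorm1D (s1 j)).
      by rewrite jensen// circle_avg_cos !mulr0 addr0.
    - exact: cl.
  by apply/funext => x; rewrite /e mulNr.
have avgh : circle_avg h = K - 2^-1 * (c2 * rho ^+ 2).
  rewrite /h circle_avgD// circle_avg_cst circle_avgD// circle_avgD// circle_avg_sum//.
  rewrite big1 => [|j _]; last by rewrite circle_avgZ// avge mulr0.
  rewrite circle_avgZ// circle_avg_cos mulr0 add0r addr0.
  rewrite (@circle_avgZ R _ (fun x => cos x ^+ 2)) ?circle_avg_cos2; first by ring.
  by have := ckc2 1; under eq_fun do rewrite mul1r.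
have := @psh_submean (polar s om) (\row_j ((rho * a 0 j)%:C * polar s om 0 j)) h ch _.
rewrite avgh wW lee_fin /K => sub.
suff : W <= W + d%:R * (N * E ^+ 2) - 2^-1 * (c2 * rho ^+ 2).
  by move: small; rewrite -/E -mulrA; lra.
apply: sub => x.
have [om' Tom' ->] := @polar_circle s om a rho x Tom k1.
have := touch (rho * cos x) (\row_j e j x) om' _ _ Tom'.
have -> : s + (rho * cos x) *: a + \row_j e j x =
    s + \row_j (2^-1 * ln (sqnorm1D (rho * a 0 j) 0 x)).
  by apply/rowP => j; rewrite !mxE /e /l; ring.
move=> /(_ _ _) touch'; apply: le_trans (touch' _ _) _.
- rewrite normrM gtr0_norm//; apply: le_lt_trans rhor0.
  rewrite -[leRHS]mulr1 ler_wpM2l ?(ltW rho0)//.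
  by rewrite ler_norml cos_geN1 cos_le1.
- by move=> j; rewrite mxE (le_lt_trans (eE j x)).
rewrite lee_fin /h /K big_split/=.
have : \sum_j N * ((\row_j e j x) 0 j) ^+ 2 <= d%:R * (N * E ^+ 2).
  rewrite mulr_natl -[X in _ *+ X]card_ord -sumr_const; apply: ler_sum => j _.
  rewrite mxE ler_wpM2l// -(real_normK (num_real (e j x))) lerXn2r// ?nnegrE//.
have -> : \sum_j m j * (\row_j e j x) 0 j = \sum_j m j * e j x.
  by apply: eq_bigr => j _; rewrite mxE.
rewrite exprMn mulNr mulrA; lra.
Qed.

End psh_basics.

(** * Logarithmic convexity *)

Section polar_topology.
Variables (R : realType) (d : nat).
Local Open Scope classical_set_scope.
Local Open Scope complex_scope.
Local Notation nC z := (normc z : R).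
Implicit Types (s a e y : 'rV[R]_d) (om z b : 'rV[R[i]]_d).

Lemma continuous_complex_scale (T : topologicalType) (f : T -> R) (g : T -> R[i]) :
  continuous f -> continuous g -> continuous (fun x => (f x)%:C * g x).
Proof.
move=> cf cg x V /nbhs_complexP[e e0 eV].
have g1 : 0 < nC (g x) + 1 by rewrite ltr_wpDl// normc_ge0.
have f1 : 0 < `|f x| + 1 by rewrite ltr_wpDl.
pose e1 := Num.min 1 (e / (2 * (nC (g x) + 1))).
have e10 : 0 < e1 by rewrite lt_min ltr01 divr_gt0// mulr_gt0.
have e20 : 0 < e / (2 * (`|f x| + 1)) by rewrite divr_gt0// mulr_gt0.
have F : \forall y \near x, `|f x - f y| < e1.
  by have /cvgrPdist_lt /(_ _ e10) := cf x.
have G : \forall y \near x, nC (g y - g x) < e / (2 * (`|f x| + 1)).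
  apply: (cg x [set u | nC (u - g x) < e / (2 * (`|f x| + 1))]).
  by apply/nbhs_complexP; exists (e / (2 * (`|f x| + 1))).
apply: filterS2 F G => y; rewrite lt_min distrC => /andP[Fy1 Fy2] Gy; apply: eV.
have -> : (f y)%:C * g y - (f x)%:C * g x =
    (f y)%:C * (g y - g x) + (f y - f x)%:C * g x by rewrite rmorphB /=; ring.
apply: le_lt_trans (le_normcD _ _) _.
rewrite !normcM !normc_real.
have fy : `|f y| <= `|f x| + 1.
  rewrite -(subrK (f x) (f y)) (le_trans (ler_normD _ _))// addrC lerD2l ltW//.
have A1 : `|f y| * nC (g y - g x) < e / 2.
  apply: (@le_lt_trans _ _ ((`|f x| + 1) * nC (g y - g x))).
    by rewrite ler_wpM2r// normc_ge0.
  move: Gy; rewrite ltr_pdivlMr ?mulr_gt0// => Gy.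
  move: Gy; move: (nC (g y - g x)) (`|f x| + 1) => u v; lra.
have A2 : `|f y - f x| * nC (g x) <= e / 2.
  apply: (@le_trans _ _ (`|f y - f x| * (nC (g x) + 1))).
    by rewrite ler_wpM2l// lerDl.
  move: Fy2; rewrite ltr_pdivlMr ?mulr_gt0// => Fy2.
  move: Fy2; move: (`|f y - f x|) (nC (g x) + 1) => u v; lra.
lra.
Qed.

(** Stated for maps f and g into the two factors, so that it covers every order of
    the product and reparametrisations of s. *)
Lemma continuous_polar_comp (T : topologicalType) (f : T -> 'rV[R]_d) (g : T -> 'rV[R[i]]_d) :
  continuous f -> continuous g -> continuous (fun x => polar (f x) (g x)).
Proof.
move=> cf cg; apply: continuous_row => j.
have -> : (fun x => polar (f x) (g x) 0 j) = (fun x => (expR (f x 0 j))%:C * g x 0 j).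
  by apply/funext => x; rewrite mxE.
apply: continuous_complex_scale => x.
  apply: continuous_comp; last exact: continuous_expR.
  by apply: (cvg_comp f (fun y : 'rV[R]_d => y 0 j)); [exact: cf|exact: continuous_coord].
by apply: (cvg_comp g (fun y : 'rV[R[i]]_d => y 0 j)); [exact: cg|exact: continuous_coord].
Qed.

Lemma nbhs_real_rowP s (V : set 'rV[R]_d) : nbhs s V ->
  exists2 r : R, 0 < r & forall y, (forall j, `|y 0 j| < r) -> V (s + y).
Proof.
move=> /nbhs_ballP[r /= r0 rV]; exists r => // y yr; apply: rV; split => // i j.
by rewrite ord1 /ball/= mxE opprD addNKr normrN.
Qed.

Variable w : 'rV[R[i]]_d -> \bar R.
Hypothesis psh_w : psh w.

(** Compactness of the torus makes the upper semicontinuity of w uniform in the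
    arguments. *)
Lemma polar_usc s0 (c : R) :
  (forall om, torus om -> (w (polar s0 om) < c%:E)%E) ->
  \forall s \near s0, forall om, torus om -> (w (polar (s : 'rV[R]_d) om) < c%:E)%E.
Proof.
move=> wc; have /compact_near_coveringP cov := @torus_compact R d.
apply: (cov _ (nbhs s0) (fun s om => (w (polar s om) < c%:E)%E)) => om Tom.
have c1 : continuous (fun p : 'rV[R[i]]_d * 'rV[R]_d => p.1) by move=> p; exact: cvg_fst.
have c2 : continuous (fun p : 'rV[R[i]]_d * 'rV[R]_d => p.2) by move=> p; exact: cvg_snd.
have cp := continuous_polar_comp c2 c1.
have H : nbhs (om, s0) [set p | (w (polar p.2 p.1) < c%:E)%E].
  apply: (cp (om, s0) [set z | (w z < c%:E)%E]); exact: psh_usc (wc _ Tom).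
exact: H.
Qed.

Lemma bigmin_pos (f : 'I_d -> R) : (forall j, 0 < f j) ->
  exists2 r, 0 < r & forall j, r <= f j.
Proof.
move=> f0; exists (\big[Num.min/1]_j f j).
  by apply: lt_bigmin.
by move=> j; apply: bigmin_le.
Qed.

Definition polar_bound s (A : R) := forall om, torus om -> (w (polar s om) <= A%:E)%E.

(** Suppose w exceeds the linear interpolation of A and B by more than 2 eta at
    s1 + la a.  Subtract from w, at s1 + tau a + y, the interpolation plus
    4 eta tau (1 - tau) + N |y|^2, and maximise over tau in [0, 1], |y_j| <= r and
    the torus.  The value at (la, 0) exceeds eta, while for small r the bounds at the
    two ends keep the values at tau = 0 and tau = 1 below eta, and for large N so are
    those with some |y_j| = r.  The maximum is thus interior, which
    no_concave_touch excludes. *)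
Theorem log_convex s1 a (A B la : R) : polar_bound s1 A -> polar_bound (s1 + a) B ->
  0 <= la <= 1 -> polar_bound (s1 + la *: a) (A + la * (B - A)).
Proof.
move=> UA UB /andP[la0 la1] om0 Tom0; rewrite leNgt; apply/negP => gt0.
have [eta eta0 gteta] : exists2 eta : R, 0 < eta &
    ((A + la * (B - A) + 2 * eta)%:E < w (polar (s1 + la *: a) om0))%E.
  case: (w _) gt0 => [r|_|//]; last by exists 1; rewrite ?ltry.
  rewrite lte_fin => lr; exists ((r - (A + la * (B - A))) / 4); first by lra.
  rewrite lte_fin; lra.
have [r [r0 r1 r2]] : exists r : R, [/\ 0 < r,
    (forall y om, (forall j, `|y 0 j| <= r) -> torus om -> (w (polar (s1 + y) om) < (A + eta)%:E)%E) &
    (forall y om, (forall j, `|y 0 j| <= r) -> torus om -> (w (polar (s1 + a + y) om) < (B + eta)%:E)%E)].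
  have AN : forall om, torus om -> (w (polar s1 om) < (A + eta)%:E)%E.
    by move=> om /UA /le_lt_trans; apply; rewrite lte_fin ltrDl.
  have BN : forall om, torus om -> (w (polar (s1 + a) om) < (B + eta)%:E)%E.
    by move=> om /UB /le_lt_trans; apply; rewrite lte_fin ltrDl.
  have [ra ra0 raA] := nbhs_real_rowP (polar_usc AN).
  have [rb rb0 rbB] := nbhs_real_rowP (polar_usc BN).
  exists (Num.min ra rb / 2).
  have m0 : 0 < Num.min ra rb by rewrite lt_min ra0.
  have ma : Num.min ra rb <= ra by rewrite ge_min lexx.
  have mb : Num.min ra rb <= rb by rewrite ge_min lexx orbT.
  clear -m0 ma mb raA rbB; move: (Num.min ra rb) m0 ma mb => m m0 ma mb.
  split=> [|y om ym Tom|y om ym Tom]; first lra.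
  - by apply: raA => // j; have := ym j; lra.
  - by apply: rbB => // j; have := ym j; lra.
pose X := (R * 'rV[R]_d * 'rV[R[i]]_d)%type.
pose K : set X := (`[0, 1] `*` [set y : 'rV[R]_d | forall j, (`[- r, r] : set R) (y ord0 j)]) `*` @torus R d.
have KP (q : X) : K q <-> [/\ 0 <= q.1.1 <= 1, forall j, `|q.1.2 0 j| <= r & torus q.2].
  split=> [[[/= + h2] h3]|[h1 h2 h3]].
    rewrite in_itv/= => h1; split => // j.
    by have := h2 j; rewrite /= in_itv/= ler_norml.
  split => //; split => /=; first by rewrite in_itv.
  by move=> j /=; rewrite in_itv/= -ler_norml.
have cK : compact K.
  apply: compact_setX; last exact: torus_compact.
  apply: compact_setX; first exact: segment_compact.
  by apply: (@rV_compact R d (fun=> `[- r, r])) => j; exact: segment_compact.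
have K0 : K ((la, 0), om0).
  by apply/KP; split; rewrite /= ?la0// => j; rewrite mxE normr0 ltW.
pose S (q : X) : 'rV[R[i]]_d := polar (s1 + q.1.1 *: a + q.1.2) q.2.
have cS : continuous S.
  apply: continuous_polar_comp; last by move=> q; exact: cvg_snd.
  apply: continuous_row => j.
  have -> : (fun q : X => (s1 + q.1.1 *: a + q.1.2) 0 j) =
      (fun q : X => s1 0 j + q.1.1 * a 0 j + q.1.2 0 j).
    by apply/funext => q; rewrite !mxE.
  have c1 : continuous (fun q : X => q.1) by move=> q; exact: cvg_fst.
  move=> q; apply: cvgD.
    apply: cvgD; first exact: cvg_cst.
    apply: cvgM; last exact: cvg_cst.
    by apply: (cvg_comp (fun q : X => q.1) fst); [exact: c1|exact: cvg_fst].
  apply: (cvg_comp (fun q : X => q.1.2) (fun y : 'rV[R]_d => y 0 j)); last exact: continuous_coord.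
  by apply: (cvg_comp (fun q : X => q.1) snd); [exact: c1|exact: cvg_snd].
have [M0 M00 wM] : exists2 M : R, 0 <= M & forall q, K q -> (w (S q) <= M%:E)%E.
  have [||p Kp pmax] := @usc_compact_max R X K (w \o S) cK.
  - by exists ((la, 0), om0).
  - move=> q c _ wc.
    by apply: (cS q [set z | (w z < c%:E)%E]); exact: psh_usc.
  have := psh_lty psh_w (S p); case E : (w (S p)) => [m|//|] _.
    exists (Num.max 0 m); first by rewrite le_max lexx.
    move=> q /pmax /=; rewrite E => /le_trans; apply.
    by rewrite lee_fin le_max lexx orbT.
  by exists 0 => // q /pmax /=; rewrite E => /le_trans; apply; exact: leNye.
(* N r^2 compensates the bound M0 for w and the least value of the interpolation *)
pose N := (M0 + `|A| + `|B|) / r ^+ 2.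
have N0 : 0 <= N by rewrite divr_ge0 ?sqr_ge0 ?addr_ge0.
pose phi (x : R) := A + x * (B - A) + 4 * eta * x * (1 - x).
pose g (q : X) := phi q.1.1 + \sum_j N * (q.1.2 0 j) ^+ 2.
have c11 : continuous (fun q : X => q.1.1).
  by move=> q; apply: (cvg_comp (fun q : X => q.1) fst); [exact: cvg_fst|exact: cvg_fst].
have cg : continuous g.
  move=> q; apply: cvgD.
    apply: cvgD.
      apply: cvgD; first exact: cvg_cst.
      by apply: cvgM; [exact: c11|exact: cvg_cst].
    apply: cvgM; first by apply: cvgM; [exact: cvg_cst|exact: c11].
    by apply: cvgB; [exact: cvg_cst|exact: c11].
  apply: cvg_big => [|j _]; first exact: add_continuous.
  apply: cvgM; first exact: cvg_cst.
  apply: (cvg_comp _ (fun y : R => y ^+ 2) _ (@exprn_continuous R 2 _)).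
  apply: (cvg_comp (fun q : X => q.1.2) (fun y : 'rV[R]_d => y 0 j)); last exact: continuous_coord.
  by apply: (cvg_comp (fun q : X => q.1) snd); [exact: cvg_fst|exact: cvg_snd].
have [||[[tau y] om] Kp pmax] := @usc_compact_max R X K (fun q => w (S q) - (g q)%:E)%E cK.
- by exists ((la, 0), om0).
- move=> q c _; rewrite lteBlDr// -EFinD => /lte_EFin_between[c' wc' cc'].
  have n1 : \forall q' \near q, (w (S q') < c'%:E)%E.
    by apply: (cS q [set z | (w z < c'%:E)%E]); exact: psh_usc.
  have n2 : \forall q' \near q, c' - c < g q'.
    by apply: (cvgr_gt _ (cg q)); lra.
  apply: filterS2 n1 n2 => q' w1 w2; rewrite lteBlDr//.
  by apply: (lt_trans w1); rewrite -EFinD lte_fin; lra.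
have /KP[/= tau01 yr Tom] := Kp.
have := pmax _ K0; rewrite /S /g /= addr0.
rewrite big1 => [|j _]; last by rewrite mxE expr0n mulr0.
rewrite addr0 => pmax0.
have {}pmax0 : (eta%:E < w (polar (s1 + tau *: a + y) om) - (phi tau + \sum_j N * y 0 j ^+ 2)%:E)%E.
  apply: lt_le_trans pmax0; rewrite EFinN lteBrDr// -EFinD; apply: le_lt_trans gteta.
  by rewrite lee_fin /phi; have := mulr_ge0 (ltW eta0) (sqr_ge0 (1 - 2 * la)); nra.
have := psh_lty psh_w (polar (s1 + tau *: a + y) om).
case EW : (w (polar (s1 + tau *: a + y) om)) pmax0 => [W|//|//] pmax0 _.
have {}pmax0 : eta + phi tau + \sum_j N * y 0 j ^+ 2 < W.
  by move: pmax0; rewrite -EFinB lte_fin; lra.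
have S0 : 0 <= \sum_j N * y 0 j ^+ 2.
  by apply: sumr_ge0 => j _; rewrite mulr_ge0// sqr_ge0.
have /andP[tau0 tau1] := tau01.
have tau0' : 0 < tau.
  rewrite lt_neqAle tau0 andbT; apply/eqP => tE.
  have := r1 _ _ yr Tom; move: EW pmax0; rewrite -tE scale0r addr0 => -> p0.
  by rewrite lte_fin; move: p0; rewrite /phi; lra.
have tau1' : tau < 1.
  rewrite lt_neqAle tau1 andbT; apply/eqP => tE.
  have := r2 _ _ yr Tom; move: EW pmax0; rewrite tE scale1r => -> p0.
  by rewrite lte_fin; move: p0; rewrite /phi; lra.
have yr' j : `|y 0 j| < r.
  rewrite lt_neqAle yr andbT; apply/eqP => yE.
  have := wM _ Kp; rewrite /S /= EW lee_fin.
  have : N * r ^+ 2 = M0 + `|A| + `|B| by rewrite /N divfK// gt_eqF// exprn_gt0.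
  have : N * r ^+ 2 <= \sum_j N * y 0 j ^+ 2.
    rewrite (bigD1 j)//= -(real_normK (num_real (y 0 j))) yE lerDl.
    by apply: sumr_ge0 => k _; rewrite mulr_ge0// sqr_ge0.
  have l1 : - (`|A| + `|B|) <= A + tau * (B - A).
    have := ler_norm (- A); have := ler_norm (- B); rewrite !normrN => nB nA.
    have t1 : 0 <= (1 - tau) * (A + `|A|) by apply: mulr_ge0; lra.
    have t2 : 0 <= tau * (B + `|B|) by apply: mulr_ge0; lra.
    have t3 : 0 <= tau * `|A| by exact: mulr_ge0.
    have t4 : 0 <= (1 - tau) * `|B| by apply: mulr_ge0 => //; lra.
    lra.
  have l2 : 0 <= 4 * eta * tau * (1 - tau) by rewrite !mulr_ge0 ?(ltW eta0)// subr_ge0.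
  by move: pmax0; rewrite /phi; lra.
have [r3 r30 r3P] : exists2 r3, 0 < r3 & forall j, r3 <= r - `|y 0 j|.
  by apply: bigmin_pos => j; rewrite subr_gt0.
pose rr := Num.min r3 (Num.min tau (1 - tau)).
have rr0 : 0 < rr by rewrite !lt_min r30 tau0' subr_gt0 tau1'.
have [rrA rrB rrC] : [/\ rr <= r3, rr <= tau & rr <= 1 - tau].
  by rewrite !ge_min !lexx !orbT.
have eta40 : 0 < 4 * eta by rewrite mulr_gt0.
apply: (@no_concave_touch R d w psh_w (s1 + tau *: a + y) om a W
  (B - A + 4 * eta * (1 - 2 * tau)) (4 * eta) N rr (fun j => 2 * N * y 0 j)) => //.
move=> p e om' prr err Tom'.
have Kq : K ((tau + p, y + e), om').
  apply/KP; split => //=.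
    by move: prr; rewrite ltr_norml => /andP[? ?]; apply/andP; split; lra.
  move=> j; rewrite mxE (le_trans (ler_normD _ _))//.
  by have := err j; have := r3P j; lra.
have := pmax _ Kq; rewrite /S /g /= EW EFinN leeBlDr// -!EFinD.
rewrite (_ : s1 + (tau + p) *: a + (y + e) = s1 + tau *: a + y + p *: a + e); last first.
  by apply/rowP => j; rewrite !mxE; ring.
move=> /le_trans; apply; rewrite lee_fin.
have -> : \sum_j N * (y + e) 0 j ^+ 2 =
    \sum_j N * y 0 j ^+ 2 + \sum_j (2 * N * y 0 j * e 0 j + N * e 0 j ^+ 2).
  by rewrite -big_split; apply: eq_bigr => j _; rewrite mxE /=; ring.
by rewrite le_eqVlt; apply/orP; left; apply/eqP; rewrite /phi; ring.
Qed.

End polar_topology.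

(** * The extremal function lies below the transform *)

Section upper_bound.
Variables (R : realType) (d : nat) (Q : 'rV[R[i]]_d -> R).
Local Open Scope classical_set_scope.
Local Open Scope complex_scope.
Local Notation nC z := (normc z : R).
Implicit Types (s t v : 'rV[R]_d) (om z : 'rV[R[i]]_d).

Hypothesis d_ge1 : (1 <= d)%N.
Hypothesis Q_C2 : C2 Q.
Hypothesis Q_torus : torus_invariant Q.

Variable w : 'rV[R[i]]_d -> \bar R.
Hypothesis lelong_w : lelong w.
Hypothesis w_le_Q : forall z, (w z <= (Q z)%:E)%E.

Let psh_w : psh w := lelong_w.1.

Lemma normc_polar s om j : torus om -> nC (polar s om 0 j) = expR (s 0 j).
Proof. by move=> Tom; rewrite mxE normcM normc_real Tom mulr1 gtr0_norm ?expR_gt0. Qed.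

Lemma Q_polar s om : torus om -> Q (polar s om) = q_of Q s.
Proof.
move=> Tom; rewrite (Q_normc Q_torus); congr Q; apply/rowP => j.
by rewrite [LHS]mxE [RHS]mxE mxE normc_polar.
Qed.

Lemma polar_bound_q s : polar_bound w s (q_of Q s).
Proof. by move=> om Tom; rewrite -(Q_polar s Tom). Qed.

Lemma polar_Log z : Cstar z -> exists2 om, torus om & z = polar (Log z) om.
Proof.
move=> Cz; have n0 j : 0 < nC (z 0 j) by rewrite normc_gt0; exact: Cz.
exists (\row_j (((nC (z 0 j))^-1)%:C * z 0 j)) => [j|].
  by rewrite mxE normcM normc_real ger0_norm ?invr_ge0 ?normc_ge0// mulVf// gt_eqF.
apply/rowP => j; rewrite !mxE lnK ?posrE// mulrA -rmorphM /= divff ?gt_eqF//.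
by rewrite mul1r.
Qed.

Lemma enorm_polar_shift s om (x : R) : torus om ->
  enorm (polar (s + const_mx x) om) = expR x * enorm (polar s om).
Proof.
move=> Tom; rewrite /enorm -[expR x]ger0_norm ?expR_ge0// -sqrtr_sqr -sqrtrM ?sqr_ge0//.
congr Num.sqrt; rewrite mulr_sumr; apply: eq_bigr => j _.
by rewrite !normc_polar// !mxE expRD; ring.
Qed.

Lemma Q_bounded_box (M : R) : exists B, forall z, (forall j, nC (z 0 j) <= M) -> Q z <= B.
Proof.
have [M0|M0] := leP 0 M; last first.
  exists 0 => z zM; have := zM (Ordinal d_ge1).
  by have := normc_ge0 (z 0 (Ordinal d_ge1)); lra.
pose K := [set x : 'rV[R]_d | forall j, (`[0, M] : set R) (x ord0 j)].
have cK : compact K.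
  by apply: (@rV_compact R d (fun=> `[0, M])) => j; exact: segment_compact.
have [||p Kp pmax] := @usc_compact_max R 'rV[R]_d K (fun x => (Q (real_row x))%:E) cK.
- by exists 0 => j /=; rewrite mxE in_itv/= lexx.
- move=> x c _; rewrite lte_fin => Qc.
  have H := @cvgr_lt R 'rV[R]_d (nbhs x) (nbhs_filter x) _ _ (@continuous_Q_real R d Q Q_C2 x) _ Qc.
  by apply: filterS H => y; rewrite lte_fin.
exists (Q (real_row p)) => z zM; rewrite (Q_normc Q_torus) -lee_fin; apply: pmax => j.
by rewrite /= mxE in_itv/= zM normc_ge0.
Qed.

(** If t_j < 0, then G would tend to infinity as s_j tends to minus infinity, where w
    is bounded by Q.  If sum_j t_j > 1, then G would outgrow the logarithmic bound
    along s0 + x (1, ..., 1). *)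
Lemma subgradient_in_simplex (G : 'rV[R]_d -> R) s0 t :
  (forall s (A : R), polar_bound w s A -> G s <= A) ->
  (forall s, G s0 + dotr t (s - s0) <= G s) -> simplex t.
Proof.
move=> Gle tG; split=> [j|].
  have [B QB] := Q_bounded_box (\big[Num.max/0]_k expR (s0 0 k)).
  have GB (x : R) : 0 <= x -> G (s0 - x *: delta_mx 0 j) <= B.
    move=> x0; apply: Gle => om Tom; apply: le_trans (w_le_Q _) _.
    rewrite lee_fin; apply: QB => k; rewrite normc_polar//.
    apply: (@le_trans _ _ (expR (s0 0 k))); last exact: le_bigmax.
    rewrite ler_expR !mxE gerBl mulr_ge0//; case: (_ && _) => //.
  rewrite leNgt; apply/negP => tj0.
  (* moving back by x raises the lower bound for G beyond B *)
  pose x := (B - G s0 + 1) / - t 0 j.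
  have BG : G s0 <= B by have := GB 0 (lexx 0); rewrite scale0r subr0.
  have x0 : 0 <= x by rewrite /x divr_ge0//; lra.
  have xt : x * - t 0 j = B - G s0 + 1 by rewrite /x divfK// oppr_eq0 lt_eqF.
  have := le_trans (tG (s0 - x *: delta_mx 0 j)) (GB _ x0).
  by rewrite addrAC subrr add0r -scaleNr dotrZr dotr_deltar; lra.
have [_ [C [M wC]]] := lelong_w.
pose om1 : 'rV[R[i]]_d := const_mx 1.
have Tom1 : torus om1 by move=> j; rewrite mxE normc1.
have enE s om : torus om -> enorm (polar s om) = enorm (polar s om1).
  move=> Tom; rewrite /enorm; congr Num.sqrt; apply: eq_bigr => j _.
  by rewrite !normc_polar.
pose E0 := enorm (polar s0 om1).
have E00 : 0 < E0.
  apply: lt_le_trans (normc_le_enorm _ (Ordinal d_ge1)).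
  by rewrite normc_polar// expR_gt0.
have GE (x : R) : ln (`|M| + 1) - ln E0 <= x -> G (s0 + const_mx x) <= Num.max 0 (x + ln E0) + C.
  move=> xM; apply: Gle => om Tom.
  have -> : x + ln E0 = ln (enorm (polar (s0 + const_mx x) om)).
    by rewrite enorm_polar_shift// enE// lnM ?posrE ?expR_gt0// expRK.
  apply: wC; rewrite enorm_polar_shift// enE//.
  have M1 : 0 < `|M| + 1 by rewrite ltr_wpDl.
  have : `|M| + 1 <= expR x * E0.
    have p0 : 0 < expR x * E0 by rewrite mulr_gt0// expR_gt0.
    rewrite -ler_ln ?posrE// lnM ?posrE ?expR_gt0// expRK.
    by move: xM; rewrite lerBlDr.
  by have := ler_norm M; rewrite -/E0; lra.
have dt x : dotr t (const_mx x) = x * \sum_j t 0 j.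
  by rewrite mulr_sumr; apply: eq_bigr => j _; rewrite mxE mulrC.
rewrite leNgt; apply/negP => t1.
pose k := \sum_j t 0 j - 1; have k0 : 0 < k by rewrite subr_gt0.
(* the first two terms bring the point into the range of the growth bound, and
   the last one, multiplied by k, exceeds all the constants *)
pose x := `|ln (`|M| + 1)| + `|ln E0| + (`|ln E0| + `|C| + `|G s0| + 1) / k.
have kx : k * x = k * (`|ln (`|M| + 1)| + `|ln E0|) + (`|ln E0| + `|C| + `|G s0| + 1).
  by rewrite /x mulrDr mulrCA divff ?gt_eqF// mulr1.
have dv0 : 0 <= (`|ln E0| + `|C| + `|G s0| + 1) / k.
  by rewrite divr_ge0 ?(ltW k0)// !addr_ge0.
have nE := ler_norm (- ln E0); have nE' := ler_norm (ln E0).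
have nM := ler_norm (ln (`|M| + 1)); have nC' := ler_norm C.
have nG := ler_norm (- G s0); rewrite !normrN in nE nG.
have xge : ln (`|M| + 1) - ln E0 <= x by rewrite /x; lra.
have xE : 0 <= x + ln E0.
  by have := normr_ge0 (ln (`|M| + 1)); rewrite /x; lra.
have := le_trans (tG (s0 + const_mx x)) (GE _ xge).
rewrite [s0 + _]addrC addrK dt max_r//.
have -> : \sum_j t 0 j = k + 1 by rewrite /k; ring.
have : 0 <= k * (`|ln (`|M| + 1)| + `|ln E0|) by rewrite mulr_ge0 ?(ltW k0)// addr_ge0.
have xk : x * (k + 1) = k * x + x by ring.
by rewrite xk kx; lra.
Qed.

(** G is the supremum of w over the torus.  It is finite everywhere as soon as w is
    finite at z: were it - oo at s, convexity on the segment from s to its reflection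
    through Log z would make it - oo at Log z. *)
Lemma le_Ifun_Log z : Cstar z -> (w z <= Ifun (@simplex R d) (f_of Q) (Log z))%E.
Proof.
move=> Cz; have [om0 Tom0 zE] := polar_Log Cz; set s0 := Log z in zE *.
case wz : (w z) => [v| |]; last by rewrite leNye.
  2: by have := psh_lty psh_w z; rewrite wz.
pose g s := ereal_sup [set w (polar s om) | om in @torus R d].
have g_ge s om : torus om -> (w (polar s om) <= g s)%E.
  by move=> Tom; apply: ereal_sup_ubound; exists om.
have g_le s A : polar_bound w s A -> (g s <= A%:E)%E.
  by move=> UA; apply: ge_ereal_sup => _ [om Tom <-]; exact: UA.
have gfin s : g s \is a fin_num.
  rewrite fin_numE; apply/andP; split; last first.
    by rewrite lt_eqF// (le_lt_trans (g_le _ _ (polar_bound_q s)))// ltry.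
  apply/eqP => gNy.
  have UA (A : R) : polar_bound w s A.
    by move=> om Tom; apply: le_trans (g_ge s om Tom) _; rewrite gNy leNye.
  (* s0 is the midpoint of s and s + a, and q bounds g at s + a *)
  pose a := 2 *: (s0 - s); pose B := q_of Q (s + a).
  have h01 : 0 <= (2^-1 : R) <= 1 by apply/andP; split; lra.
  have := log_convex psh_w (UA (2 * (v - 1) - B)) (@polar_bound_q (s + a)) h01 Tom0.
  have -> : s + 2^-1 *: a = s0.
    by rewrite /a scalerA mulVf// scale1r addrC subrK.
  rewrite -zE wz lee_fin -/B; lra.
pose G s := fine (g s).
have GE s : g s = (G s)%:E by rewrite fineK.
have UG s : polar_bound w s (G s) by move=> om Tom; rewrite -GE; exact: g_ge.
have Gle s A : polar_bound w s A -> G s <= A.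
  by move=> /g_le; rewrite GE lee_fin.
have convG s1 s2 (la : R) : 0 <= la <= 1 ->
    G (s1 + la *: (s2 - s1)) <= G s1 + la * (G s2 - G s1).
  move=> la01; apply/Gle/log_convex => //.
  by rewrite addrC subrK.
have [t tG] := subgradient convG s0.
have tS := subgradient_in_simplex Gle tG.
apply: (@le_trans _ _ (G s0)%:E); first by rewrite -wz zE; exact: UG.
apply: (@le_trans _ _ ((dotr s0 t)%:E + lne (f_of Q t))%E); last first.
  by apply: ereal_sup_ubound; exists t.
have dC : dotr s0 t = dotr t s0 by apply: eq_bigr => j _; rewrite mulrC.
rewrite lne_f_of dC.
have uG : (u_of Q t <= (dotr t s0 - G s0)%:E)%E.
  apply: ge_ereal_sup => _ [s _ <-]; rewrite lee_fin.
  have := tG s; have := Gle s _ (polar_bound_q s).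
  by rewrite dotrDr -scaleN1r dotrZr; lra.
apply: (@le_trans _ _ ((dotr t s0)%:E - (dotr t s0 - G s0)%:E)%E).
  by rewrite -EFinB lee_fin; lra.
by apply: leeB.
Qed.

(** The circle around z in the direction of its vanishing coordinates has nonzero
    coordinates. *)
Lemma le_Phi z : (w z <= Phi (@simplex R d) (f_of Q) z)%E.
Proof.
apply: le_ereal_inf_tmp => _ [V FV <-].
set S := ereal_sup _.
have key (c : R) : (S <= c%:E)%E -> (w z <= c%:E)%E.
  move=> Sc; have /nbhs_rowP[e e0 eV] := FV.
  pose b : 'rV[R[i]]_d := \row_j (if z 0 j == 0 then e / 2 else 0)%:C.
  have cc : continuous (fun _ : R => c) by move=> x; exact: cvg_cst.
  rewrite -(circle_avg_cst c); apply: (psh_submean psh_w (b := b) cc) => x.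
  set zeta := z + _.
  have n1 : nC (cos x +i* sin x) = 1 by rewrite /= cos2Dsin2 sqrtr1.
  have e20 : 0 < e / 2 by rewrite divr_gt0.
  have Cz : Cstar zeta.
    move=> j; rewrite !mxE; case: (eqVneq (z 0 j) 0) => [-> |zj0]; last by rewrite mulr0 addr0.
    by rewrite add0r -normc_gt0 normcM n1 mul1r normc_real gtr0_norm.
  have Vz : V zeta.
    apply: eV => // j; rewrite !mxE addrAC subrr add0r normcM n1 mul1r normc_real.
    by case: ifPn => _; rewrite ?normr0// gtr0_norm//; lra.
  apply: le_trans (le_Ifun_Log Cz) _; apply: le_trans Sc.
  by apply: ereal_sup_ubound; exists zeta.
case ES : S key => [r|//|] key; [exact: key|exact: leey|].
case: (w z) key => [v| |//] key.
  by have := key _ (leNye (v - 1)%:E); rewrite lee_fin lerBrDr gerDl ler10.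
by have := key _ (leNye 0%:E).
Qed.

End upper_bound.

Theorem proposition5p9 (R : realType) (d : nat) (d_ge1 : (1 <= d)%N)
  (Q : 'rV[R[i]]_d -> R)
  (Q_ge0 : forall z, 0 <= Q z)
  (Q_C2 : C2 Q)
  (Q_torus : torus_invariant Q)
  (Q_growth : exists eps R0 : R, [/\ 0 < eps, 0 < R0 &
     forall z, R0 <= enorm z -> (1 + eps) * ln (enorm z) <= Q z]) :
  Phi (@simplex R d) (f_of Q) = weighted_extremal Q /\
  ddc (Phi (@simplex R d) (f_of Q)) = ddc (weighted_extremal Q).
Proof.
have E : Phi (@simplex R d) (f_of Q) = weighted_extremal Q.
  apply/funext => z; apply/eqP; rewrite eq_le; apply/andP; split.
    exact: Phi_le_weighted_extremal.
  apply: ge_ereal_sup => _ [w [Lw wQ] <-].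
  exact: (le_Phi d_ge1 Q_C2 Q_torus Lw wQ).
by split; rewrite E.
Qed.
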